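(* Let $\mathcal{U}\subset\mathrm{Diff}^1(\mathbb{T}^3)$ be the open set, and for $g\in\mathcal{U}$ let $\Lambda_g$ be the unique quasi-attractor of $g$ and $h_g$ the semiconjugacy from $g$ to $A$, all described in the context. For every $g\in\mathcal{U}$, every chain recurrence class of $g$ different from $\Lambda_g$ is contained in the relative interior (with respect to the center stable leaves of $\mathcal{F}^{cs}_g$) of $h_g^{-1}(\mathcal{O})$, for some periodic orbit $\mathcal{O}$ of $A$.
   Context: Construction of $\mathcal{U}$. $A:\mathbb{T}^3\to\mathbb{T}^3$ is a linear Anosov diffeomorphism with hyperbolic splitting $E^s\oplus E^u$, $\dim E^s=2$, with complex (non-real) eigenvalues on $E^s$, and with $\|DA|_{E^s}\|<\lambda$, $\|(DA|_{E^u})^{-1}\|<\lambda$ for some $\lambda<1/3$; $p,q,r$ are distinct fixed points of $A$. For $\delta>0$ put $V_1=B(p,\delta)$, $V_2=B(p,6\delta)$, $W_1=B(q,\delta)$, $W_2=B(q,6\delta)$, $B=B(r,6\delta)$; $\delta$ is fixed so small that $V_2,W_2,B$ are pairwise disjoint and at distance larger than $200\delta$, and distinct connected components of the preimages of $V_2$ and $W_2$ in $\mathbb{R}^3$ are at distance larger than $200\delta$. $\mathcal{C}^u$ is a family of closed cones around $E^u$ with $D_xA(\mathcal{C}^u(x))\subset\mathrm{int}\,\mathcal{C}^u(Ax)$, so narrow that, for some $L>0$, any curve tangent to $\mathcal{C}^u$ of length bigger than $L$ meets every disc of radius $\delta$ in the stable foliation of $A$; $\mathcal{C}^{cs}$ is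 a family of closed cones around $E^s$ invariant under $DA^{-1}$. The constants $\varepsilon\ll\delta$ and $\nu\ll\delta$ are small, with $\nu$ such that every diffeomorphism $g$ that is $\nu$-$C^0$-close to $A$ admits a continuous surjection $h_g:\mathbb{T}^3\to\mathbb{T}^3$, $\varepsilon$-$C^0$-close to the identity, with $h_g\circ g=A\circ h_g$. $f$ is a diffeomorphism, equal to $A$ outside $V_1\cup W_1$, at $C^0$ distance less than $\nu/2$ from $A$, such that: (a) $p$ is a hyperbolic repelling fixed point of $f$; (b) $q$ is a hyperbolic saddle fixed point with one-dimensional stable manifold of length larger than $\delta$, and the product of its two eigenvalues of smaller modulus is larger than $1$; (c) $D_xf(\mathcal{C}^u(x))\subset\mathrm{int}\,\mathcal{C}^u(f(x))$, $\|Df^{-1}_xw\|<\lambda\|w\|$ for $w\in\mathcal{C}^u(x)\setminus\{0\}$, and $f$ preserves the stable foliation of $A$; (d) $\|D_xfv\|<\lambda\|v\|$ for $x\notin V_1\cup W_1$, $v\in\mathcal{C}^{cs}(x)\setminus\{0\}$, and, for some small $\beta>0$, $\|D_xfv\|<(1+\beta)\|v\|$ for all $x$ and $v\in\mathcal{C}^{cs}(x)\setminus\{0\}$. $\mathcal{U}$ is a sufficiently small $C^1$-neighborhood of $f$: every $g\in\mathcal{U}$ is $\nu$-$C^0$-close to $A$ (so $h_g$ exists); satisfies (a), (b), (d) with the hyperbolic continuations $p_g,q_g$, and the cone invariance and expansion in $\mathcal{C}^u$; preserves a foliation $\mathcal{F}^{cs}_g$ with two-dimensional leaves, $C^1$-close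 to those of the stable foliation of $A$, tangent to a $Dg$-invariant bundle $E^{cs}_g\subset\mathcal{C}^{cs}$; every curve of length $L$ tangent to $\mathcal{C}^u$ meets every disc of radius $2\delta$ in $\mathcal{F}^{cs}_g$; and the stable manifold of the continuation $r_g$ of $r$ contains a center stable disc of radius bigger than $2\delta$. Chain recurrence classes: an $\eta$-pseudo orbit from $x$ to $y$ is $x=x_0,\dots,x_k=y$, $k\geq1$, with $d(g(x_i),x_{i+1})<\eta$; the chain recurrence classes are the equivalence classes, on the set of points $x$ having an $\eta$-pseudo orbit from $x$ to $x$ for all $\eta>0$, of the relation ''for all $\eta>0$ there are $\eta$-pseudo orbits from $x$ to $y$ and from $y$ to $x$''. A quasi-attractor is a chain recurrence class $\Lambda$ with a decreasing sequence of open neighborhoods $U_n$, $\Lambda=\bigcap_nU_n$, $g(\overline{U_n})\subset U_n$. Every $g\in\mathcal{U}$ has exactly one quasi-attractor, denoted $\Lambda_g$. Each fiber $h_g^{-1}(\{y\})$ is contained in a single leaf of $\mathcal{F}^{cs}_g$ (in the disc of radius $2\delta$ in the leaf around any of its points); the relative interior of $h_g^{-1}(\mathcal{O})$ is the union over $y\in\mathcal{O}$ of the interior of $h_g^{-1}(\{y\})$ in that leaf. *)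

(* Defs.v *)
From HB Require Import structures.
From mathcomp Require Import all_boot all_order all_algebra.
From mathcomp Require Import archimedean generic_quotient complex.
From mathcomp Require Import all_classical all_reals all_analysis.

Set Implicit Arguments.
Unset Strict Implicit.
Unset Printing Implicit Defensive.

Import Order.TTheory GRing.Theory Num.Theory.
Import numFieldNormedType.Exports.

Local Open Scope classical_set_scope.
Local Open Scope ring_scope.
Local Open Scope quotient_scope.

(* Vectors are rows, so a matrix acts by [v *m M]; the norm of the torus is the
  Euclidean one (the library's norm on ['rV_n] is the sup norm and is used for
  its topology only). *)

Definition enorm (R : realType) (v : 'rV[R]_3) : R :=
  Num.sqrt (\sum_i v 0 i ^+ 2).

Definition eucl_dist (R : realType) (x y : 'rV[R]_3) : R := enorm (x - y).

Definition lattice_eq (R : realType) : rel 'rV[R]_3 :=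
  fun x y => [forall i, (x - y) 0 i \is a Num.int].

Lemma lattice_eq_equiv (R : realType) : equiv_class_of (@lattice_eq R).
Proof.
split => [x|x y|y x z].
- by apply/forallP => i; rewrite subrr mxE rpred0.
- apply/forallP/forallP => H i; move: (H i);
    by rewrite -opprB mxE rpredN.
- move=> /forallP xy /forallP yz; apply/forallP => i.
  have -> : x - z = (x - y) + (y - z) by rewrite addrA subrK.
  by rewrite mxE rpredD.
Qed.

Canonical lattice_eq_equiv_rel (R : realType) :=
  EquivRelPack (lattice_eq_equiv R).

Definition torus (R : realType) : Type :=
  quotient_topology {eq_quot (@lattice_eq R)}.
HB.instance Definition _ (R : realType) :=
  PointedTopological.copy (torus R)
    (quotient_topology {eq_quot (@lattice_eq R)}).

Definition tproj (R : realType) (x : 'rV[R]_3) : torus R := \pi_(torus R) x.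

Definition tdist (R : realType) (x y : torus R) : R :=
  inf [set eucl_dist u v | u in [set u | tproj u = x]
                     & v in [set v | tproj v = y]].

Definition tball (R : realType) (x : torus R) (e : R) : set (torus R) :=
  [set y | tdist x y < e].

Definition far_apart (R : realType) (T : Type) (d : T -> T -> R) (e : R)
    (A B : set T) : Prop :=
  A `&` B = set0 /\ e < inf [set d x y | x in A & y in B].

Definition lifts (R : realType) (G : 'rV[R]_3 -> 'rV[R]_3)
    (g : torus R -> torus R) : Prop :=
  continuous G /\ forall x, tproj (G x) = g (tproj x).

Definition C1_map (R : realType) (m n : nat)
    (G : 'rV[R]_m.+1 -> 'rV[R]_n.+1) : Prop :=
  (forall x, differentiable G x) /\
  continuous (fun x => 'J G x : 'M[R]_(m.+1, n.+1)).

Definition C1_diffeo (R : realType) (g : torus R -> torus R) : Prop :=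
  bijective g /\
  exists G, [/\ lifts G g, C1_map G & forall x, 'J G x \in unitmx].

(* Two lifts of the same map differ by an integer translation, so that neither
   the lift selected here nor the representative used in [tderiv] matters. *)
Definition tlift (R : realType) (g : torus R -> torus R) :
    'rV[R]_3 -> 'rV[R]_3 :=
  xget (idfun : 'rV[R]_3 -> 'rV[R]_3) [set G | lifts G g].

Definition tderiv (R : realType) (g : torus R -> torus R) (x : torus R) :
    'M[R]_3 :=
  'J (tlift g) (repr x).

Definition C0_close (R : realType) (e : R) (f g : torus R -> torus R) : Prop :=
  forall x, tdist (f x) (g x) < e.

Definition C1_close (R : realType) (e : R) (f g : torus R -> torus R) : Prop :=
  C0_close e f g /\
  forall x v, enorm (v *m (tderiv f x - tderiv g x)) <= e * enorm v.

Definition C1_open (R : realType) (U : set (torus R -> torus R)) : Prop :=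
  U `<=` @C1_diffeo R /\
  forall g, U g -> exists2 e : R, 0 < e &
    forall g', C1_diffeo g' -> C1_close e g g' -> U g'.

Definition cmx (R : realType) (n : nat) (M : 'M[R]_n) : 'M[R[i]]_n :=
  map_mx (real_complex R) M.

Definition hyperbolic_fixed (R : realType) (g : torus R -> torus R)
    (x : torus R) : Prop :=
  g x = x /\ forall z, eigenvalue (cmx (tderiv g x)) z -> `|z| != 1.

Definition repelling_fixed (R : realType) (g : torus R -> torus R)
    (x : torus R) : Prop :=
  g x = x /\ forall z, eigenvalue (cmx (tderiv g x)) z -> 1 < `|z|.

Definition stable_set (R : realType) (g : torus R -> torus R) (x : torus R) :
    set (torus R) :=
  [set y | tdist (iter n g y) (iter n g x) @[n --> \oo] --> (0 : R)].

(* The family [c] is the hyperbolic continuation of the fixed point [x] of [f]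
   over [U]: [c g] is the only fixed point of [g] in a fixed neighbourhood of
   [x], and it depends continuously on [g]. *)
Definition hyperbolic_continuation (R : realType)
    (U : set (torus R -> torus R)) (f : torus R -> torus R) (x : torus R)
    (c : (torus R -> torus R) -> torus R) : Prop :=
  [/\ c f = x,
      forall g, U g -> hyperbolic_fixed g (c g),
      exists V : set (torus R), [/\ open V, V x &
        forall g, U g -> [set y | g y = y] `&` V = [set c g]] &
      forall g, U g -> forall e : R, 0 < e -> exists2 eta : R, 0 < eta &
        forall g', U g' -> C1_close eta g g' -> tdist (c g) (c g') < e].

(* Curves are parametrized by [0, 1] and live in the universal cover. *)

Definition C1_curve (R : realType) (gam : R -> 'rV[R]_3) : Prop :=
  (forall t, derivable gam t 1) /\ continuous (derive1 gam).

Definition curve_length (R : realType) (gam : R -> 'rV[R]_3) : R :=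
  \int[lebesgue_measure]_(t in `[0, 1]%classic) enorm (derive1 gam t).

Definition tangent_curve (R : realType) (C : torus R -> set 'rV[R]_3)
    (gam : R -> 'rV[R]_3) : Prop :=
  C1_curve gam /\
  forall t, 0 <= t <= 1 ->
    derive1 gam t != 0 /\ C (tproj (gam t)) (derive1 gam t).

(* The one-dimensional stable manifold of [q] has length larger than [l]. *)
Definition stable_arc (R : realType) (g : torus R -> torus R) (q : torus R)
    (l : R) : Prop :=
  exists gam : R -> 'rV[R]_3,
    [/\ tangent_curve (fun=> setT) gam, {in `[0, 1] &, injective gam},
        exists2 t, 0 <= t <= 1 & tproj (gam t) = q,
        forall t, 0 <= t <= 1 -> stable_set g q (tproj (gam t)) &
        l < curve_length gam].

(* A foliation is given by its lift to the universal cover: [leaf x] is the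
   leaf through [x].  Discs are balls for the length metric of the leaves. *)
Definition lifted_disc (R : realType) (leaf : 'rV[R]_3 -> set 'rV[R]_3)
    (x : 'rV[R]_3) (rho : R) : set 'rV[R]_3 :=
  [set y | exists gam : R -> 'rV[R]_3,
    [/\ C1_curve gam, gam 0 = x, gam 1 = y,
        forall t, 0 <= t <= 1 -> leaf x (gam t) & curve_length gam < rho]].

Definition leaf_disc (R : realType) (leaf : 'rV[R]_3 -> set 'rV[R]_3)
    (x : torus R) (rho : R) : set (torus R) :=
  @tproj R @` lifted_disc leaf (repr x) rho.

Definition hits_disc (R : realType) (gam : R -> 'rV[R]_3) (D : set (torus R)) :
    Prop :=
  exists2 t, 0 <= t <= 1 & D (tproj (gam t)).

Definition preserves_foliation (R : realType) (g : torus R -> torus R)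
    (leaf : 'rV[R]_3 -> set 'rV[R]_3) : Prop :=
  forall x, tlift g @` leaf x = leaf (tlift g x).

Definition plane_field (R : realType) (E : torus R -> 'M[R]_3) : Prop :=
  continuous E /\
  forall x, [/\ E x *m E x = E x, (E x)^T = E x & \rank (E x) = 2%N].

(* A foliation of the torus that is [kappa]-[C^1]-close to the linear foliation
   by translates of the plane [Es] and tangent to the plane field [E] (a plane
   being the row space of its orthogonal projection): upstairs, the leaf
   through [x] is the graph over [x + Es] of a [C^1] map into [Eu] of
   [C^1]-size at most [kappa].  As the leaves partition the space and each one
   is a graph over the whole of [Es], they meet every translate of [Eu] exactly
   once, which provides a global foliation chart. *)
Definition C1_close_foliation (R : realType) (Es : 'M[R]_(2, 3))
    (Eu : 'rV[R]_3) (kappa : R) (leaf : 'rV[R]_3 -> set 'rV[R]_3)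
    (E : torus R -> 'M[R]_3) : Prop :=
  [/\ forall x, leaf x x,
      forall x y, leaf x y -> leaf y = leaf x,
      forall x y, tproj x = tproj y ->
        leaf y = [set z + (y - x) | z in leaf x] &
      forall x, exists phi : 'rV[R]_2 -> 'rV[R]_1,
        let pt s := x + s *m Es + phi s *m Eu in
        [/\ C1_map phi, phi 0 = 0, leaf x = range pt,
            forall s, enorm (phi s *m Eu) < kappa /\
              forall w, enorm (w *m 'J phi s *m Eu) <= kappa * enorm (w *m Es) &
            forall s, ((Es + 'J phi s *m Eu)%R == E (tproj (pt s)))%MS]].

Definition pseudo_orbit (R : realType) (g : torus R -> torus R) (eta : R)
    (x y : torus R) : Prop :=
  exists (k : nat) (u : nat -> torus R),
    [/\ (1 <= k)%N, u 0%N = x, u k = y &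
        forall i, (i < k)%N -> tdist (g (u i)) (u i.+1) < eta].

Definition chain_recurrent (R : realType) (g : torus R -> torus R)
    (x : torus R) : Prop :=
  forall eta : R, 0 < eta -> pseudo_orbit g eta x x.

Definition chain_equiv (R : realType) (g : torus R -> torus R)
    (x y : torus R) : Prop :=
  forall eta : R, 0 < eta -> pseudo_orbit g eta x y /\ pseudo_orbit g eta y x.

Definition chain_class (R : realType) (g : torus R -> torus R)
    (C : set (torus R)) : Prop :=
  exists2 x, chain_recurrent g x &
    C = [set y | chain_recurrent g y /\ chain_equiv g x y].

Definition quasi_attractor (R : realType) (g : torus R -> torus R)
    (Lam : set (torus R)) : Prop :=
  chain_class g Lam /\
  exists U : nat -> set (torus R),
    [/\ forall n, open (U n) /\ Lam `<=` U n,
        forall n, U n.+1 `<=` U n,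
        Lam = \bigcap_n U n &
        forall n, g @` closure (U n) `<=` U n].

Definition periodic_orbit (R : realType) (g : torus R -> torus R)
    (O : set (torus R)) : Prop :=
  exists (y : torus R) (n : nat),
    [/\ (0 < n)%N, iter n g y = y & O = range (fun k => iter k g y)].

(* [Es] and [Eu] are matrices whose rows form bases of the two bundles;
  [cone_u], [cone_cs] are the apertures of the cone fields and [Lu] is the
  length beyond which unstable curves meet all stable discs. *)

Record anosov_data (R : realType) := AnosovData {
  amat : 'M[int]_3;
  Es : 'M[R]_(2, 3);
  Eu : 'rV[R]_3;
  lam : R;
  fix_p : torus R;
  fix_q : torus R;
  fix_r : torus R;
  delta : R;
  cone_u : torus R -> R;
  cone_cs : torus R -> R;
  Lu : R
}.

Section AnosovDefs.
Variables (R : realType) (S : anosov_data R).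

Definition rmat : 'M[R]_3 := map_mx intr (amat S).

Definition Amap (x : torus R) : torus R := tproj (repr x *m rmat).

Definition V1 := tball (fix_p S) (delta S).
Definition V2 := tball (fix_p S) (6 * delta S).
Definition W1 := tball (fix_q S) (delta S).
Definition W2 := tball (fix_q S) (6 * delta S).
Definition Br := tball (fix_r S) (6 * delta S).

(* closed cone of aperture [a] around [E], with complementary space [F] *)
Definition cone (m n : nat) (E : 'M[R]_(m, 3)) (F : 'M[R]_(n, 3)) (a : R) :
    set 'rV[R]_3 :=
  [set v | exists e f : 'rV[R]_3,
    [/\ (e <= E)%MS, (f <= F)%MS, v = e + f & enorm f <= a * enorm e]].

Definition Cu (x : torus R) : set 'rV[R]_3 := cone (Eu S) (Es S) (cone_u S x).
Definition Ccs (x : torus R) : set 'rV[R]_3 := cone (Es S) (Eu S) (cone_cs S x).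

Definition stable_leaf (x : 'rV[R]_3) : set 'rV[R]_3 :=
  [set y | ((y - x)%R <= Es S)%MS].

Definition cone_invariance (g : torus R -> torus R) : Prop :=
  forall x v, Cu x v -> v != 0 -> interior (Cu (g x)) (v *m tderiv g x).

(* [|D_y g^-1 w| < lam |w|] for [w] in [C^u(y)], written at [y = g x] *)
Definition cone_expansion (g : torus R -> torus R) : Prop :=
  forall x w, Cu (g x) w -> w != 0 ->
    enorm (w *m invmx (tderiv g x)) < lam S * enorm w.

Definition cs_contraction (beta : R) (g : torus R -> torus R) : Prop :=
  forall x v, Ccs x v -> v != 0 ->
    (~ (V1 `|` W1) x -> enorm (v *m tderiv g x) < lam S * enorm v) /\
    enorm (v *m tderiv g x) < (1 + beta) * enorm v.

(* hyperbolic saddle with a one-dimensional stable manifold of length larger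
   than [delta]; the eigenvalues are listed by increasing modulus, and [1 < _]
   in [R[i]] says that the product is a real number larger than 1 *)
Definition saddle_fixed (g : torus R -> torus R) (x : torus R) : Prop :=
  [/\ g x = x,
      exists mu1 mu2 mu3 : R[i],
        [/\ char_poly (cmx (tderiv g x)) =
              ('X - mu1%:P) * ('X - mu2%:P) * ('X - mu3%:P),
            `|mu1| < 1, 1 < `|mu2|, `|mu2| <= `|mu3| & 1 < mu1 * mu2] &
      stable_arc g x (delta S)].

Record anosov_setting : Prop := {
  amat_unit : amat S \in unitmx;
  Es_rank : \rank (Es S) = 2%N;
  Eu_rank : \rank (Eu S) = 1%N;
  Es_Eu_sum : (1%:M <= Es S + Eu S)%MS;
  Es_stable : stablemx (Es S) rmat;
  Eu_stable : stablemx (Eu S) rmat;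
  Es_complex : forall z : R[i],
    eigenvalue (cmx (conjmx (row_base (Es S)) rmat)) z -> complex.Im z != 0;
  lam_lt : lam S < 3^-1;
  Es_contracted : forall v : 'rV[R]_3, (v <= Es S)%MS -> v != 0 ->
    enorm (v *m rmat) < lam S * enorm v;
  Eu_expanded : forall v : 'rV[R]_3, (v <= Eu S)%MS -> v != 0 ->
    enorm (v *m invmx rmat) < lam S * enorm v;
  fixed_points : [/\ Amap (fix_p S) = fix_p S, Amap (fix_q S) = fix_q S &
    Amap (fix_r S) = fix_r S];
  distinct_points : [/\ fix_p S <> fix_q S, fix_p S <> fix_r S &
    fix_q S <> fix_r S];
  delta_gt0 : 0 < delta S;
  balls_far : [/\ far_apart (@tdist R) (200 * delta S) V2 W2,
    far_apart (@tdist R) (200 * delta S) V2 Br &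
    far_apart (@tdist R) (200 * delta S) W2 Br];
  components_far : let P := @tproj R @^-1` (V2 `|` W2) in
    forall x y, P x -> P y ->
      connected_component P x <> connected_component P y ->
      far_apart (@eucl_dist R) (200 * delta S)
        (connected_component P x) (connected_component P y);
  cone_u_gt0 : forall x, 0 < cone_u S x;
  cone_u_cont : continuous (cone_u S);
  cone_u_inv : forall x v, Cu x v -> v != 0 ->
    interior (Cu (Amap x)) (v *m rmat);
  Lu_gt0 : 0 < Lu S;
  cone_u_narrow : forall gam, tangent_curve Cu gam ->
    Lu S < curve_length gam ->
    forall x, hits_disc gam (leaf_disc stable_leaf x (delta S));
  cone_cs_gt0 : forall x, 0 < cone_cs S x;
  cone_cs_cont : continuous (cone_cs S);
  cone_cs_inv : forall x v, Ccs (Amap x) v -> Ccs x (v *m invmx rmat)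
}.

Definition semiconjugacy (eps : R) (g h : torus R -> torus R) : Prop :=
  [/\ continuous h, forall y, exists x, h x = y,
      C0_close eps h id & forall x, h (g x) = Amap (h x)].

Definition semiconjugacy_constant (eps nu : R) : Prop :=
  forall g, C1_diffeo g -> C0_close nu g Amap ->
    exists h, semiconjugacy eps g h.

Record modified_diffeo (nu beta : R) (f : torus R -> torus R) : Prop := {
  mod_diffeo : C1_diffeo f;
  mod_eq : forall x, ~ (V1 `|` W1) x -> f x = Amap x;
  mod_close : C0_close (nu / 2) f Amap;
  mod_p : repelling_fixed f (fix_p S);
  mod_q : saddle_fixed f (fix_q S);
  mod_cone_inv : cone_invariance f;
  mod_cone_exp : cone_expansion f;
  mod_foliation : preserves_foliation f stable_leaf;
  mod_cs : cs_contraction beta f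
}.

(* What is required of a [C^1]-open neighbourhood [U] of [f]; [pc], [qc], [rc]
   are the continuations of the fixed points, and [Fcs g], [Ecs g] are the
   center stable foliation and bundle of [g]. *)
Record good_neighborhood (nu beta kappa : R) (f : torus R -> torus R)
    (U : set (torus R -> torus R))
    (pc qc rc : (torus R -> torus R) -> torus R)
    (Fcs : (torus R -> torus R) -> 'rV[R]_3 -> set 'rV[R]_3)
    (Ecs : (torus R -> torus R) -> torus R -> 'M[R]_3) : Prop := {
  nb_open : C1_open U;
  nb_mem : U f;
  nb_close : forall g, U g -> C0_close nu g Amap;
  nb_p : hyperbolic_continuation U f (fix_p S) pc;
  nb_q : hyperbolic_continuation U f (fix_q S) qc;
  nb_r : hyperbolic_continuation U f (fix_r S) rc;
  nb_repelling : forall g, U g -> repelling_fixed g (pc g);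
  nb_saddle : forall g, U g -> saddle_fixed g (qc g);
  nb_cs : forall g, U g -> cs_contraction beta g;
  nb_cone_inv : forall g, U g -> cone_invariance g;
  nb_cone_exp : forall g, U g -> cone_expansion g;
  nb_bundle : forall g, U g -> [/\ plane_field (Ecs g),
    forall x, (Ecs g x *m tderiv g x == Ecs g (g x))%MS &
    forall x (v : 'rV[R]_3), (v <= Ecs g x)%MS -> Ccs x v];
  nb_foliation : forall g, U g ->
    C1_close_foliation (Es S) (Eu S) kappa (Fcs g) (Ecs g);
  nb_preserved : forall g, U g -> preserves_foliation g (Fcs g);
  nb_meets : forall g, U g -> forall gam, tangent_curve Cu gam ->
    curve_length gam = Lu S ->
    forall x, hits_disc gam (leaf_disc (Fcs g) x (2 * delta S));
  nb_r_disc : forall g, U g -> exists (x : torus R) (rho : R),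
    2 * delta S < rho /\ leaf_disc (Fcs g) x rho `<=` stable_set g (rc g)
}.

End AnosovDefs.

Definition relative_interior (R : realType)
    (leaf : 'rV[R]_3 -> set 'rV[R]_3) (h : torus R -> torus R)
    (O : set (torus R)) : set (torus R) :=
  \bigcup_(y in O) [set x | h x = y /\
    exists2 rho : R, 0 < rho & leaf_disc leaf x rho `<=` h @^-1` [set y]].

(* Main.v *)
Require Import Defs.
From mathcomp Require Import all_boot all_order all_algebra.
From mathcomp Require Import generic_quotient ring lra zify.
From mathcomp Require Import all_classical all_reals all_analysis.

(* Fix a trapping region [U] around the quasi-attractor [Lam] that misses a point
   of [C]; chain recurrence then keeps all of [C], with its forward orbits and
   the pseudo-orbits joining its points, outside [U].  Lift [h] to [H] on the
   universal cover.  The key fact is that outside [U] the component of [H] along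
   [Es] is locally constant: were it not constant on a small segment, backward
   iteration would blow up the stable size of the segment by a factor [3] at each
   step, and since the balls around the lifts of [p] and [q] are far apart one
   could repeatedly pass to a subarc that stays away from them.  This gives a
   point of the segment whose backward orbit eventually avoids [V1] and [W1], so
   that forward iteration contracts center stable discs of radius [2 delta]
   around its far past into a neighbourhood of the segment that misses [g U].
   But [g U] contains arbitrarily long unstable curves, which meet every such
   disc.

   So near a point [x] of [C] the map [h] takes values in the unstable leaf of
   [h x]; as [h] also maps center stable leaves to stable leaves, [x] is in the
   relative interior of its fiber.  By the pigeonhole principle two points of the
   orbit of [x] return close to each other infinitely often, hence their images,
   which lie on a common unstable leaf at all these times, coincide: [h x] is
   periodic.  Finally a pseudo-orbit from [x] to [x'] outside [U] puts [h x] on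
   the unstable leaf of a point of the orbit of [h x'], and two periodic points on
   the same unstable leaf are equal. *)

Set Implicit Arguments.
Unset Strict Implicit.
Unset Printing Implicit Defensive.

Import Order.TTheory GRing.Theory Num.Theory.
Import numFieldNormedType.Exports.

Local Open Scope classical_set_scope.
Local Open Scope ring_scope.

Local Ltac vec_ring := by apply/rowP => ?; rewrite !mxE; ring.

(** * The Euclidean norm *)

Section EuclideanNorm.
Variable R : realType.
Implicit Types u v w : 'rV[R]_3.

Lemma enormE v : enorm v = Num.sqrt (v 0 0 ^+ 2 + v 0 1 ^+ 2 + v 0 2%:R ^+ 2).
Proof.
rewrite /enorm !big_ord_recr big_ord0 /= add0r.
by congr (Num.sqrt (v _ _ ^+ 2 + v _ _ ^+ 2 + v _ _ ^+ 2)); exact: val_inj.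
Qed.

Lemma enorm_ge0 v : 0 <= enorm v.
Proof. exact: sqrtr_ge0. Qed.

Lemma sqr_enorm v : enorm v ^+ 2 = v 0 0 ^+ 2 + v 0 1 ^+ 2 + v 0 2%:R ^+ 2.
Proof. by rewrite enormE sqr_sqrtr// !addr_ge0// sqr_ge0. Qed.

Lemma enorm0 : enorm (0 : 'rV[R]_3) = 0.
Proof. by rewrite enormE !mxE expr0n/= !addr0 sqrtr0. Qed.

Lemma coord_le_enorm v i : `|v 0 i| <= enorm v.
Proof.
rewrite -sqrtr_sqr ler_wsqrtr// (bigD1 i)//= lerDl.
by apply: sumr_ge0 => *; exact: sqr_ge0.
Qed.

Lemma enorm_eq0 v : (enorm v == 0) = (v == 0).
Proof.
apply/eqP/eqP => [v0|->]; last exact: enorm0.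
apply/rowP => i; rewrite mxE; apply/eqP; rewrite -normr_le0 -v0.
exact: coord_le_enorm.
Qed.

Lemma enorm_gt0 v : (0 < enorm v) = (v != 0).
Proof. by rewrite lt_def enorm_eq0 enorm_ge0 andbT. Qed.

Lemma enormZ a v : enorm (a *: v) = `|a| * enorm v.
Proof.
rewrite !enormE !mxE !exprMn -!mulrDr sqrtrM ?sqr_ge0//.
by rewrite sqrtr_sqr.
Qed.

Lemma enormN v : enorm (- v) = enorm v.
Proof. by rewrite -scaleN1r enormZ normrN1 mul1r. Qed.

Lemma enormBC u v : enorm (u - v) = enorm (v - u).
Proof. by rewrite -enormN opprB. Qed.

Definition edot u v : R := (u *m v^T) 0 0.

Lemma edotE u v : edot u v = u 0 0 * v 0 0 + u 0 1 * v 0 1 + u 0 2%:R * v 0 2%:R.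
Proof.
rewrite /edot mxE !big_ord_recr big_ord0 /= add0r !mxE.
by congr (u _ _ * v _ _ + u _ _ * v _ _ + u _ _ * v _ _); exact: val_inj.
Qed.

(** Cauchy-Schwarz through Lagrange's identity: after squaring, the difference of the two sides is
    the sum of the squares of the minors [a * y - b * x], [a * z - c * x] and [b * z - c * y]. *)
Lemma edot_le u v : edot u v <= enorm u * enorm v.
Proof.
apply: (le_trans (ler_norm _)).
rewrite -(@ler_pXn2r _ 2)// ?nnegrE ?mulr_ge0 ?enorm_ge0//.
rewrite exprMn !sqr_enorm edotE real_normK ?num_real//.
set a := u 0 0; set b := u 0 1; set c := u 0 _.
set x := v 0 0; set y := v 0 1; set z := v 0 _.
rewrite -subr_ge0.
rewrite (_ : _ - _ = (a * y - b * x) ^+ 2 + (a * z - c * x) ^+ 2 +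
  (b * z - c * y) ^+ 2); last by ring.
by rewrite !addr_ge0// sqr_ge0.
Qed.

Lemma edotvv v : edot v v = enorm v ^+ 2.
Proof. by rewrite sqr_enorm edotE !expr2. Qed.

Lemma ler_enormD u v : enorm (u + v) <= enorm u + enorm v.
Proof.
rewrite -(@ler_pXn2r _ 2)// ?nnegrE ?addr_ge0 ?enorm_ge0//.
rewrite sqrrD -[in leLHS]edotvv.
have -> : edot (u + v) (u + v) = edot u u + (edot u v) *+ 2 + edot v v.
  by rewrite !edotE !mxE; ring.
by rewrite !edotvv lerD2r lerD2l lerMn2r edot_le.
Qed.

Lemma ler_enormB u v : enorm (u - v) <= enorm u + enorm v.
Proof. by rewrite -(enormN v) ler_enormD. Qed.

Lemma ler_enorm_distD w u v : enorm (u - v) <= enorm (u - w) + enorm (w - v).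
Proof. by rewrite -{1}(subrK w u) -addrA ler_enormD. Qed.

Lemma lerB_enorm u v : enorm u - enorm v <= enorm (u - v).
Proof. by rewrite lerBlDr -{1}(subrK v u) ler_enormD. Qed.

Lemma enorm_le_coord v e : (forall i, `|v 0 i| <= e) -> enorm v <= 3 * e.
Proof.
move=> ve; have e0 : 0 <= e := le_trans (normr_ge0 _) (ve 0).
rewrite -(@ler_pXn2r _ 2)// ?nnegrE ?mulr_ge0 ?enorm_ge0// sqr_enorm.
have H i : v 0 i ^+ 2 <= e ^+ 2.
  by rewrite -real_normK ?num_real// ler_pXn2r// nnegrE.
have := H 0; have := H 1; have := H 2%:R; have := sqr_ge0 e; rewrite exprMn; lra.
Qed.

(** Passes from the library's topology, given by the sup norm, to the Euclidean norm. The radius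
    [e / 4] suffices because the two norms differ by a factor at most 3. *)
Lemma nbhs_enormP v (A : set 'rV[R]_3) :
  nbhs v A <-> exists2 e, 0 < e & forall w, enorm (w - v) < e -> A w.
Proof.
split=> [/nbhs_ballP[e /= e0 vA]|[e e0 vA]].
  exists e => // w wv; apply: vA; split=> // i j.
  rewrite /ball/= distrC (le_lt_trans _ wv)// ord1.
  by have := coord_le_enorm (w - v) j; rewrite !mxE.
apply/nbhs_ballP; exists (e / 4); first by rewrite /= divr_gt0.
move=> w [_ vw]; apply: vA; apply: (@le_lt_trans _ _ (3 * (e / 4))); last first.
  by lra.
apply: enorm_le_coord => i; rewrite !mxE distrC ltW//.
exact: vw.
Qed.

Lemma continuous_enormP (T : topologicalType) (f : T -> 'rV[R]_3) x :
  {for x, continuous f} <->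
  forall e, 0 < e -> \forall y \near x, enorm (f y - f x) < e.
Proof.
split=> [fx e e0|H A /nbhs_enormP[e e0 eA]].
  by apply: (fx [set w | enorm (w - f x) < e]); apply/nbhs_enormP; exists e.
by apply: filterS (H _ e0) => y; exact: eA.
Qed.

Lemma enorm_continuous : continuous (@enorm R).
Proof.
move=> v; have := nbhs_filter v => vF; apply/(@cvgrPdist_lt _ _ _ _ vF) => e e0.
apply/nbhs_enormP; exists e => // w wv.
rewrite ltr_norml ltrNl opprB !(le_lt_trans (lerB_enorm _ _))//.
by rewrite enormBC.
Qed.

Lemma enorm_mulmx_le (M : 'M[R]_3) :
  exists2 K, 0 < K & forall v, enorm (v *m M) <= K * enorm v.
Proof.
pose m := \sum_i \sum_j `|M i j|.
have m0 : 0 <= m by apply: sumr_ge0 => i _; apply: sumr_ge0 => j _.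
exists (3 * m + 1) => [|v]; first by rewrite ltr_wpDl// mulr_ge0.
apply: (@le_trans _ _ (3 * (m * enorm v))); last first.
  by have := enorm_ge0 v; lra.
apply: enorm_le_coord => i; rewrite mxE (le_trans (ler_norm_sum _ _ _))//.
rewrite mulr_suml ler_sum// => j _.
rewrite normrM mulrC ler_pM// ?coord_le_enorm//.
by rewrite (bigD1 i)//= lerDl sumr_ge0.
Qed.

End EuclideanNorm.

(** * The torus *)

Section Torus.
Variable R : realType.
Implicit Types (u v w k : 'rV[R]_3) (x y : torus R).

Definition intvec k : Prop := forall i, k 0 i \is a Num.int.

Lemma intvecN k : intvec k -> intvec (- k).
Proof. by move=> kZ i; rewrite mxE rpredN. Qed.

Lemma intvecD k k' : intvec k -> intvec k' -> intvec (k + k').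
Proof. by move=> kZ kZ' i; rewrite mxE rpredD. Qed.

Lemma intvecB k k' : intvec k -> intvec k' -> intvec (k - k').
Proof. by move=> kZ kZ'; apply: intvecD => //; exact: intvecN. Qed.

Lemma intvecM k (M : 'M[int]_3) :
  intvec k -> intvec (k *m map_mx intr M).
Proof.
move=> kZ i; rewrite mxE; apply: rpred_sum => j _.
by rewrite mxE rpredM// intr_int.
Qed.

Lemma intvec_lt1_eq0 k : intvec k -> enorm k < 1 -> k = 0.
Proof.
move=> kZ k1; apply/rowP => i; rewrite mxE.
have /intrP[m mE] := kZ i.
have := le_lt_trans (coord_le_enorm k i) k1.
rewrite mE -intr_norm -[1]/(1%:~R) ltr_int => m1.
by have -> : m = 0 by lia.
Qed.

Lemma intvec_ge1 k : intvec k -> k != 0 -> 1 <= enorm k.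
Proof. by move=> kZ /eqP; rewrite leNgt => k0; apply/negP => /(intvec_lt1_eq0 kZ). Qed.

(** The lattice is discrete: two lattice points within 1/4 of [v] coincide. If the first one found
    were not [v], a second one strictly nearer to [v] would have to equal it. *)
Lemma intvec_closed v :
  (forall e, 0 < e -> exists2 k, intvec k & enorm (v - k) < e) ->
  intvec v.
Proof.
move=> H; have [|k kZ vk] := H (4^-1); first by lra.
have [->//|vNk] := eqVneq v k.
have [|k' k'Z vk'] := H (Num.min 4^-1 (enorm (v - k))).
  by rewrite lt_min enorm_gt0 subr_eq0 vNk andbT; lra.
move: vk'; rewrite lt_min => /andP[vk'1 vk'2].
have : k - k' = 0.
  apply: intvec_lt1_eq0; first exact: intvecB.
  by have := ler_enorm_distD v k k'; rewrite (enormBC k v); lra.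
by move/subr0_eq => kk'; rewrite kk' ltxx in vk'2.
Qed.

Lemma exists_nearest_intvec v :
  exists2 k, intvec k & enorm (v - k) <= 3 / 2.
Proof.
exists (\row_i (Num.floor (v 0 i + 1 / 2))%:~R).
  by move=> i; rewrite mxE intr_int.
apply: enorm_le_coord => i; rewrite !mxE ler_norml.
by have := floor_itv (v 0 i + 1 / 2); rewrite intrD => /andP[]; lra.
Qed.

Lemma exists_unit_cube v :
  exists2 k, intvec k & forall i, 0 <= (v - k) 0 i < 1.
Proof.
exists (\row_i (Num.floor (v 0 i))%:~R); first by move=> i; rewrite mxE intr_int.
move=> i; rewrite !mxE.
by have := floor_itv (v 0 i); rewrite intrD => /andP[]; lra.
Qed.

Lemma tprojP u v : tproj u = tproj v <-> intvec (u - v).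
Proof.
split=> [/(@eqquotP _ _ (torus R))|uv].
  by rewrite /= /lattice_eq => /forallP.
by apply/(@eqquotP _ _ (torus R)); apply/forallP.
Qed.

Lemma tprojD u k : intvec k -> tproj (u + k) = tproj u.
Proof. by move=> kZ; apply/tprojP; rewrite addrC addKr. Qed.

Lemma tproj_repr x : tproj (repr x) = x.
Proof. exact: reprK. Qed.

Lemma tproj_continuous : continuous (@tproj R).
Proof. exact: pi_continuous. Qed.

Lemma tproj_open (V : set 'rV[R]_3) : open V -> open (@tproj R @` V).
Proof.
move=> Vo; rewrite /open/= /quotient_open -/(tproj).
rewrite openE => u [v Vv vu]; apply/nbhs_enormP.
have /nbhs_enormP[e e0 eV] : nbhs v V by move: Vo; rewrite openE; exact.
exists e => // w wu; exists (w + (v - u)); last first.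
  by apply: tprojD; apply/tprojP.
by apply: eV; rewrite (_ : _ - v = w - u)//; vec_ring.
Qed.

Lemma tdist_le u v : tdist (tproj u) (tproj v) <= enorm (u - v).
Proof.
apply: ge_inf; first by exists 0 => _ [a _ [b _ <-]]; exact: enorm_ge0.
by exists u => //; exists v.
Qed.

(** Lattice translations are isometries, so a pair of lifts that nearly realizes the infimum can be
    translated until its first point is the prescribed [u]. *)
Lemma tdist_lt u y e : tdist (tproj u) y < e ->
  exists2 v, tproj v = y & enorm (u - v) < e.
Proof.
move=> ue; have [|_ [u' /= u'u [v' /= v'y <-]] uv'] := inf_lt _ ue.
  exists (eucl_dist u (repr y)); exists u => //; exists (repr y) => //.
  exact: tproj_repr.
exists (v' + (u - u')); first by rewrite tprojD//; apply/tprojP.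
by rewrite (_ : u - _ = u' - v')//; vec_ring.
Qed.

Lemma tdistxx x : tdist x x <= 0.
Proof.
by rewrite -(tproj_repr x); have := tdist_le (repr x) (repr x); rewrite subrr enorm0.
Qed.

Lemma tdistC x y : tdist x y = tdist y x.
Proof.
congr inf; apply/seteqP; split => _ [a aP [b bP <-]];
  by exists b => //; exists a => //; rewrite /eucl_dist enormBC.
Qed.

Lemma tdist_le_lift x y : tdist x y <= 3 / 2.
Proof.
rewrite -(tproj_repr x) -(tproj_repr y).
have [k kZ uv] := exists_nearest_intvec (repr x - repr y).
by rewrite -(tprojD (repr y) kZ) (le_trans (tdist_le _ _))// opprD addrA.
Qed.

(** Together with [nbhs_tball], this identifies the quotient topology with the topology of
    [tdist]. *)
Lemma nbhs_torus x (A : set (torus R)) : nbhs x A ->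
  exists2 e, 0 < e & forall y, tdist x y < e -> A y.
Proof.
move=> xA; have : nbhs (repr x) (@tproj R @^-1` A).
  by apply: tproj_continuous; rewrite -/(tproj _) tproj_repr.
move=> /nbhs_enormP[e e0 eA]; exists e => // y xy.
rewrite -(tproj_repr x) in xy; have [v <- rv] := tdist_lt xy.
by apply: eA; rewrite enormBC.
Qed.

End Torus.

(** * Trapping regions and chain classes *)

Section TorusTopology.
Variable R : realType.
Implicit Types x y z : torus R.

Lemma tdist_ltD y x z a b : tdist x y < a -> tdist y z < b -> tdist x z < a + b.
Proof.
rewrite -{1 2}(tproj_repr x) => /tdist_lt[v <- xv] /tdist_lt[w <- vw].
rewrite (le_lt_trans (tdist_le _ _))// (le_lt_trans (ler_enorm_distD v _ _))//.
exact: ltrD.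
Qed.

Lemma nbhs_tball x e : 0 < e -> nbhs x (tball x e).
Proof.
move=> e0; pose V := [set w : 'rV[R]_3 | enorm (w - repr x) < e].
have Vo : open V.
  rewrite openE => w Vw; apply/nbhs_enormP.
  exists (e - enorm (w - repr x)) => [|v vw]; first by rewrite subr_gt0.
  rewrite /V/= (le_lt_trans (ler_enorm_distD w _ _))//.
  by rewrite -ltrBrDr.
have VtE : @tproj R @` V `<=` tball x e.
  move=> _ [w Vw <-]; rewrite /tball/= -{1}(tproj_repr x).
  by rewrite (le_lt_trans (tdist_le _ _))// enormBC.
apply: filterS VtE _; apply: open_nbhs_nbhs; split; first exact: tproj_open.
by exists (repr x); [rewrite /V/= subrr enorm0|exact: tproj_repr].
Qed.

Lemma torus_compact : compact [set: torus R].
Proof.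
pose Q := [set v : 'rV[R]_3 | forall i, `[0, 1]%classic (v ord0 i)].
have -> : [set: torus R] = @tproj R @` Q.
  apply/seteqP; split => // x _; have [k kZ xk] := exists_unit_cube (repr x).
  exists (repr x - k).
    by move=> i; have /andP[x0 /ltW x1] := xk i; rewrite /= in_itv/= x0.
  by rewrite (tprojD _ (intvecN kZ)) tproj_repr.
apply: continuous_compact.
  by apply: continuous_subspaceT => v; exact: tproj_continuous.
by apply: (@rV_compact R 3 (fun=> `[0, 1]%classic)) => _; exact: segment_compact.
Qed.

End TorusTopology.

Section Trapping.
Variables (R : realType) (g : torus R -> torus R).
Implicit Types (x y : torus R) (U C : set (torus R)).

Definition trapping U := open U /\ g @` closure U `<=` U.

(** Uniform room around the image: a pseudo-orbit with jumps smaller than [rho] that enters [U]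
    never leaves it. *)
Definition trapping_margin U (rho : R) :=
  0 < rho /\ forall x y, U x -> tdist (g x) y < rho -> U y.

Hypothesis g_cont : continuous g.

(** Each point of the compact set [closure U] has a neighbourhood with a common admissible radius;
    the near-covering form of compactness makes the radius uniform. *)
Lemma exists_trapping_margin U :
  trapping U -> exists rho, trapping_margin U rho.
Proof.
move=> [Uo gU].
have Kc : compact (closure U).
  apply: (@subclosed_compact _ _ [set: torus R]) => //; last exact: torus_compact.
  exact: closed_closure.
have := (compact_near_coveringP (closure U)).1 Kc R (0^'+)
  (fun rho x => forall y, tdist (g x) y < rho -> U y) _.
case=> [x Kx|].
  have /nbhs_torus[e e0 eU] : nbhs (g x) U.
    by apply: open_nbhs_nbhs; split=> //; apply: gU; exists x.
  have e20 : 0 < e / 2 by rewrite divr_gt0.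
  exists ([set x' | tdist (g x) (g x') < e / 2], [set r | r < e / 2]) => /=.
    split; last exact: nbhs_right_lt.
    exact: (g_cont (nbhs_tball (g x) e20)).
  move=> [x' r] /= [xx' re] y x'y; apply: eU.
  rewrite (splitr e); apply: tdist_ltD xx' _; exact: lt_trans re.
move=> e /= e0 eU; exists (e / 2); split; first by rewrite divr_gt0.
move=> x y Ux; apply: (eU (e / 2)) => //=.
- by rewrite sub0r normrN gtr0_norm ?divr_gt0// ltr_pdivrMr// ltr_pMr// ltr1n.
- by rewrite divr_gt0.
- exact: subset_closure.
Qed.

Lemma trapping_preimage U : trapping U -> trapping (g @^-1` U).
Proof.
move=> [Uo gU]; split; first by apply: open_comp => // x _; exact: g_cont.
move=> _ [x xU <-]; apply: gU; exists (g x) => // A /g_cont/xU[z [Uz Az]].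
by exists (g z).
Qed.

Lemma trapped_tail U rho (u : nat -> torus R) k i j :
  trapping_margin U rho ->
  (forall l, (l < k)%N -> tdist (g (u l)) (u l.+1) < rho) ->
  U (u i) -> (i <= j <= k)%N -> U (u j).
Proof.
move=> [rho0 Urho] ug Ui /andP[]; elim: j => [|j IH] ij jk.
  by move: ij Ui; rewrite leqn0 => /eqP ->.
move: ij; rewrite leq_eqVlt => /predU1P[<-//|ij].
by apply: Urho (ug _ jk); apply: IH => //; exact: ltnW.
Qed.

Lemma pseudo_orbit_trans eta x y z :
  pseudo_orbit g eta x y -> pseudo_orbit g eta y z -> pseudo_orbit g eta x z.
Proof.
move=> [k [u [k1 u0 uk ug]]] [l [v [l1 v0 vl vg]]].
exists (k + l)%N, (fun i => if (i < k)%N then u i else v (i - k)%N); split.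
- by rewrite (leq_trans k1)// leq_addr.
- by rewrite k1.
- by rewrite ltnNge leq_addr/= addKn.
- move=> i ikl; case: ltnP => ik.
    case: ltnP => [iSk|ki]; first exact: ug.
    have iSk : i.+1 = k by apply/eqP; rewrite eqn_leq ki ik.
    rewrite iSk.
    by rewrite subnn v0 -uk; have := ug _ ik; rewrite iSk.
  by rewrite ltnNge leqW//= subSn//; apply: vg; rewrite ltn_subLR.
Qed.

Lemma chain_equiv_trans x y z :
  chain_equiv g x y -> chain_equiv g y z -> chain_equiv g x z.
Proof.
move=> xy yz e e0; have [? ?] := xy e e0; have [? ?] := yz e e0.
by split; apply: (@pseudo_orbit_trans _ _ y).
Qed.

Lemma chain_equivC x y : chain_equiv g x y -> chain_equiv g y x.
Proof. by move=> xy e /xy[]. Qed.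

Lemma chain_class_equiv C x y : chain_class g C -> C x -> C y -> chain_equiv g x y.
Proof.
move=> [z _ ->] [_ zx] [_ zy]; apply: chain_equiv_trans zy; exact: chain_equivC.
Qed.

Lemma chain_class_recurrent C x : chain_class g C -> C x -> chain_recurrent g x.
Proof. by move=> [z _ ->] []. Qed.

Lemma chain_class_subset_eq C C' :
  chain_class g C -> chain_class g C' -> C `<=` C' -> C = C'.
Proof.
move=> [x xr CE] [x' xr' CE'] CC'.
have [_ x'x] : [set y | chain_recurrent g y /\ chain_equiv g x' y] x.
  by rewrite -CE'; apply: CC'; rewrite CE; split=> // e e0; split; exact: xr.
rewrite CE CE'; apply/seteqP; split=> y [yr xy]; split=> //.
  exact: chain_equiv_trans xy.
by apply: chain_equiv_trans xy; exact: chain_equivC.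
Qed.

Lemma chain_class_trapped C U x y :
  chain_class g C -> trapping U -> C x -> C y -> U x -> U y.
Proof.
move=> Cc /exists_trapping_margin[rho Urho] Cx Cy Ux.
have [] := chain_class_equiv Cc Cx Cy Urho.1.
move=> [k [u [k1 u0 uk ug]]] _.
by rewrite -uk; apply: (@trapped_tail _ _ _ _ 0) ug _ _; rewrite ?u0 ?leqnn.
Qed.

(** A closing pseudo-orbit of [x] first jumps to a point near [g x], hence inside the open set [U];
    it cannot leave [U] afterwards, and it ends at [x]. *)
Lemma chain_recurrent_trapped x U :
  chain_recurrent g x -> trapping U -> U (g x) -> U x.
Proof.
move=> xr Ut Ugx; have [rho Urho] := exists_trapping_margin Ut.
have /nbhs_torus[e e0 eU] : nbhs (g x) U.
  by apply: open_nbhs_nbhs; split=> //; exact: Ut.1.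
have [|k [u [k1 u0 uk ug]]] := xr (Num.min e rho).
  by rewrite lt_min e0 Urho.1.
have {}ug l : (l < k)%N -> tdist (g (u l)) (u l.+1) < e /\ tdist (g (u l)) (u l.+1) < rho.
  by move=> /ug; rewrite lt_min => /andP.
rewrite -uk; apply: (@trapped_tail _ _ _ k 1 _ Urho); last by rewrite k1 leqnn.
  by move=> l /ug[].
by apply: eU; rewrite -u0; exact: (ug _ k1).1.
Qed.

(** Induction on [n] with [U] varying, since the preimage of a trapping region is again trapping. *)
Lemma chain_recurrent_iter_trapped x U n :
  chain_recurrent g x -> trapping U -> U (iter n g x) -> U x.
Proof.
move=> xr; elim: n U => [//|n IH] U Ut; rewrite iterS => Ugn.
apply: chain_recurrent_trapped => //.
have /(_ (trapping_preimage Ut) Ugn) := IH (g @^-1` U).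
exact.
Qed.

End Trapping.

(** * Lifts *)

Lemma mulmxr_inj (K : nzRingType) (m n : nat) (M N : 'M[K]_(m, n)) :
  (forall v : 'rV[K]_m, v *m M = v *m N) -> M = N.
Proof. by move=> MN; apply/row_matrixP => i; rewrite !rowE. Qed.

(** Differentials depend on increments only. This serves for lifts that differ by a translation, in
    the target or in the source. *)
Lemma eq_jacobian (K : numFieldType) (F G : 'rV[K]_3 -> 'rV[K]_3) u w :
  differentiable F u -> differentiable G w ->
  (forall v, F (v + u) - F u = G (v + w) - G w) -> 'J F u = 'J G w.
Proof.
move=> dF dG FG; apply: mulmxr_inj => v.
apply: etrans (esym (deriveEjacobian v dF)) _.
apply: etrans (deriveEjacobian v dG); rewrite /derive.
suff -> : (fun h : K => h^-1 *: ((F \o shift u) (h *: v) - F u)) =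
  (fun h : K => h^-1 *: ((G \o shift w) (h *: v) - G w)) by [].
by apply/funext => h; rewrite /= FG.
Qed.

Section Lifts.
Variable R : realType.
Implicit Types (u v k : 'rV[R]_3) (F G : 'rV[R]_3 -> 'rV[R]_3).

Lemma mulmxr_continuous (M : 'M[R]_3) : continuous (fun v : 'rV[R]_3 => v *m M).
Proof.
move=> v; apply/continuous_enormP => e e0.
have [K K0 MK] := enorm_mulmx_le M.
apply/nbhs_enormP; exists (e / K) => [|w wv]; first by rewrite divr_gt0.
by rewrite -mulmxBl (le_lt_trans (MK _))// mulrC -ltr_pdivlMr.
Qed.

(** If [phi] took two distinct integer values, the intermediate value theorem would give it a
    half-integer value. *)
Lemma continuous_int_segment (phi : R -> R) (a b : R) : a <= b ->
  continuous phi -> (forall t, phi t \is a Num.int) -> phi a = phi b.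
Proof.
move=> ab phic phiZ.
have noval (m : int) c : phi c <> m%:~R + 1 / 2.
  have /intrP[n ->] := phiZ c => nm.
  have : (2 * n)%:~R = (2 * m + 1)%:~R :> R by rewrite intrD !intrM; lra.
  by move/eqP; rewrite eqr_int; lia.
apply/eqP/negPn/negP => phiab.
have phiw := @continuous_subspaceT _ _ `[a, b]%classic _ phic.
have /intrP[m mE] := phiZ a; have /intrP[n nE] := phiZ b.
have [mn|nm] : (m + 1 <= n \/ n + 1 <= m)%R.
  by move: phiab; rewrite mE nE eqr_int; lia.
- have [|c _ cE] := @IVT _ _ _ _ (m%:~R + 1 / 2) ab phiw; last exact: (noval m c).
  have : (m + 1)%:~R <= n%:~R :> R by rewrite ler_int.
  by rewrite intrD mE nE ge_min le_max; lra.
- have [|c _ cE] := @IVT _ _ _ _ (n%:~R + 1 / 2) ab phiw; last exact: (noval n c).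
  have : (n + 1)%:~R <= m%:~R :> R by rewrite ler_int.
  by rewrite intrD mE nE ge_min le_max; lra.
Qed.

Lemma continuous_intvec_cst F :
  continuous F -> (forall u, intvec (F u)) -> forall u, F u = F 0.
Proof.
move=> Fc FZ u; apply/rowP => i.
have := @continuous_int_segment (fun t : R => F (t *: u) 0 i) 0 1 ler01.
rewrite scale0r scale1r => <- //; last by move=> t; exact: FZ.
move=> t.
apply: (@continuous_comp _ _ _ (fun t : R => F (t *: u)) (fun v : 'rV[R]_3 => v 0 i)).
  apply: (@continuous_comp _ _ _ (fun t : R => t *: u) F); last exact: Fc.
  exact: scalel_continuous.
exact: coord_continuous.
Qed.

Variable g : torus R -> torus R.

Lemma lifts_unique F G : lifts F g -> lifts G g ->
  exists2 k, intvec k & forall u, F u = G u + k.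
Proof.
move=> [Fc Fg] [Gc Gg].
have Z u : intvec (F u - G u) by apply/tprojP; rewrite Fg Gg.
exists (F 0 - G 0) => [//|u].
have FGc : continuous (F \- G).
  by move=> v; apply: continuousB; [exact: Fc|exact: Gc].
by have /= <- := continuous_intvec_cst FGc Z u; rewrite addrC subrK.
Qed.

Lemma lifts_translate F k : lifts F g -> intvec k ->
  exists2 l, intvec l & forall u, F (u + k) = F u + l.
Proof.
move=> Fl kZ; have [Fc Fg] := Fl.
have Fkl : lifts (fun u => F (u + k)) g.
  split; last by move=> u; rewrite Fg tprojD.
  move=> u; apply: (@continuous_comp _ _ _ (fun u => u + k) F); last exact: Fc.
  by apply: continuousD => //; exact: cst_continuous.
exact: lifts_unique Fkl Fl.
Qed.

Lemma lifts_continuous F : lifts F g -> continuous g.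
Proof.
move=> [Fc Fg]; apply/quotient_continuous.
have -> : g \o \pi_(torus R)%qT = @tproj R \o F by apply/funext => u /=; rewrite Fg.
by move=> u; apply: continuous_comp; [exact: Fc|exact: tproj_continuous].
Qed.

Hypothesis g_diffeo : C1_diffeo g.

Lemma tlift_lifts : lifts (tlift g) g.
Proof.
have [_ [G [Gl _ _]]] := g_diffeo.
exact: (xgetPex (idfun : 'rV[R]_3 -> 'rV[R]_3) (ex_intro (fun G => lifts G g) G Gl)).
Qed.

(** [tlift g] is selected among continuous lifts only; its regularity comes from its differing by a
    constant from a lift of class C^1. *)
Lemma tlift_C1 : C1_map (tlift g) /\ forall u, 'J (tlift g) u \in unitmx.
Proof.
have [_ [G [Gl GC1 GJ]]] := g_diffeo.
have [k _ kE] := lifts_unique tlift_lifts Gl.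
have {}kE : tlift g = G + cst k by apply/funext => u; rewrite kE.
have JE u : 'J (tlift g) u = 'J G u.
  apply: (@eq_jacobian R); [|exact: GC1.1|]; last by move=> v; rewrite kE; vec_ring.
  by rewrite kE; apply: differentiableD => //; exact: GC1.1.
split; last by move=> u; rewrite JE.
split; first by move=> u; rewrite kE; apply: differentiableD => //; exact: GC1.1.
by rewrite (_ : (fun x => _) = (fun x => 'J G x)); [exact: GC1.2|exact/funext].
Qed.

Lemma tderivE u : tderiv g (tproj u) = 'J (tlift g) u.
Proof.
rewrite /tderiv; set v := repr _.
have kZ : intvec (v - u) by apply/tprojP; exact: tproj_repr.
have [l _ lE] := lifts_translate tlift_lifts kZ.
apply: (@eq_jacobian R); [exact: tlift_C1.1.1|exact: tlift_C1.1.1|] => w.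
have vE z : z + v = z + u + (v - u) by vec_ring.
by rewrite -[v in X in _ - X]add0r !vE add0r !lE; vec_ring.
Qed.

End Lifts.

(** * The hyperbolic splitting of the linear map *)

Lemma mulmxXSr (K : nzRingType) m n (v : 'M[K]_(m, n.+1)) (M : 'M[K]_n.+1) i :
  v *m M ^+ i.+1 = v *m M ^+ i *m M.
Proof. by rewrite (_ : M ^+ i.+1 = M ^+ i *m M) ?mulmxA//; exact: exprSr. Qed.

Lemma mulmxXS (K : nzRingType) m n (v : 'M[K]_(m, n.+1)) (M : 'M[K]_n.+1) i :
  v *m M ^+ i.+1 = v *m M *m M ^+ i.
Proof. by rewrite (_ : M ^+ i.+1 = M *m M ^+ i) ?mulmxA//; exact: exprS. Qed.

Lemma mulmxXK (K : nzRingType) m n (v : 'M[K]_(m, n.+1)) (M N : 'M[K]_n.+1) i :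
  M *m N = 1%:M -> v *m M ^+ i *m N ^+ i = v.
Proof.
move=> MN; elim: i v => [|i IH] v; first by rewrite !expr0 !mulmx1.
by rewrite (mulmxXSr v) (mulmxXS _ N) -(mulmxA (v *m M ^+ i) M N) MN mulmx1 IH.
Qed.

Section AnosovLinear.
Variables (R : realType) (S : anosov_data R) (HS : anosov_setting S).
Implicit Types (e f u v w k : 'rV[R]_3) (n : nat).

Local Notation B := (rmat S).
Local Notation iB := (map_mx intr (invmx (amat S)) : 'M[R]_3).
Local Notation Es := (Es S).
Local Notation Eu := (Eu S).
Local Notation lam := (lam S).

(** The inverse is formed over the integers before passing to the reals, so that [iB] preserves the
    lattice by [intvecM]. *)
Lemma rmatK : B *m iB = 1%:M.
Proof. by rewrite -map_mxM mulmxV ?map_mx1//; exact: amat_unit HS. Qed.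

Lemma rmatVK : iB *m B = 1%:M.
Proof. by rewrite -map_mxM mulVmx ?map_mx1//; exact: amat_unit HS. Qed.

Lemma rmat_unit : B \in unitmx.
Proof. by have [] := mulmx1_unit rmatK. Qed.

Lemma invmx_rmat : invmx B = iB.
Proof. by rewrite -[LHS]mulmx1 -rmatK mulmxA mulVmx ?rmat_unit// mul1mx. Qed.

Lemma capmx_EsEu : (Es :&: Eu)%MS = 0.
Proof.
apply/eqP; rewrite -mxrank_eq0.
have := mxrank_sum_cap Es Eu; rewrite (Es_rank HS) (Eu_rank HS).
have /eqP -> : \rank (Es + Eu)%MS == 3%N.
  have := mxrankS (Es_Eu_sum HS); rewrite mxrank1 => r3.
  by rewrite eqn_leq rank_leq_col.
by lia.
Qed.

(** [proj_mx] takes square matrices, so the bases are first replaced by square matrices with the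
    same row spaces. *)
Definition proj_s : 'M[R]_3 := proj_mx <<Es>>%MS <<Eu>>%MS.
Definition proj_u : 'M[R]_3 := proj_mx <<Eu>>%MS <<Es>>%MS.
Local Notation Ps := proj_s.
Local Notation Pu := proj_u.

Let cap0 : (<<Es>> :&: <<Eu>>)%MS = 0 :> 'M[R]_3.
Proof.
by apply/eqP; rewrite -submx0 (cap_eqmx (genmxE _) (genmxE _)) capmx_EsEu submx0.
Qed.

Let cap0' : (<<Eu>> :&: <<Es>>)%MS = 0 :> 'M[R]_3.
Proof. by rewrite capmxC. Qed.

Lemma proj_s_sub v : (v *m Ps <= Es)%MS.
Proof. by rewrite (submx_trans (proj_mx_sub _ _ _))// genmxE. Qed.

Lemma proj_u_sub v : (v *m Pu <= Eu)%MS.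
Proof. by rewrite (submx_trans (proj_mx_sub _ _ _))// genmxE. Qed.

Lemma proj_s_id e : (e <= Es)%MS -> e *m Ps = e.
Proof. by move=> eE; apply: proj_mx_id; rewrite ?genmxE. Qed.

Lemma proj_u_id e : (e <= Eu)%MS -> e *m Pu = e.
Proof. by move=> eE; apply: proj_mx_id; rewrite ?genmxE. Qed.

Lemma proj_s0 e : (e <= Eu)%MS -> e *m Ps = 0.
Proof. by move=> eE; apply: proj_mx_0; rewrite ?genmxE. Qed.

Lemma proj_u0 e : (e <= Es)%MS -> e *m Pu = 0.
Proof. by move=> eE; apply: proj_mx_0; rewrite ?genmxE. Qed.

Lemma proj_su v : v *m Ps + v *m Pu = v.
Proof.
apply: add_proj_mx; rewrite ?cap0// addsmxE.
rewrite (submx_trans (submx1 _))// (submx_trans (Es_Eu_sum HS))//.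
by rewrite -addsmxE addsmxS// genmxE.
Qed.

Lemma Es_rmat e : (e <= Es)%MS -> (e *m B <= Es)%MS.
Proof. by move=> eE; rewrite (submx_trans (submxMr _ eE))//; exact: Es_stable HS. Qed.

Lemma Eu_rmat e : (e <= Eu)%MS -> (e *m B <= Eu)%MS.
Proof. by move=> eE; rewrite (submx_trans (submxMr _ eE))//; exact: Eu_stable HS. Qed.

Lemma proj_s_comm v : v *m B *m Ps = v *m Ps *m B.
Proof.
rewrite -{1}(proj_su v) !mulmxDl (proj_s_id (Es_rmat (proj_s_sub v))).
by rewrite (proj_s0 (Eu_rmat (proj_u_sub v))) addr0.
Qed.

Lemma proj_u_comm v : v *m B *m Pu = v *m Pu *m B.
Proof.
rewrite -{1}(proj_su v) !mulmxDl (proj_u_id (Eu_rmat (proj_u_sub v))).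
by rewrite (proj_u0 (Es_rmat (proj_s_sub v))) add0r.
Qed.

Lemma proj_s_commV v : v *m iB *m Ps = v *m Ps *m iB.
Proof.
rewrite -[LHS]mulmx1 -rmatK mulmxA -proj_s_comm -(mulmxA v).
by rewrite rmatVK mulmx1.
Qed.

Lemma proj_u_commV v : v *m iB *m Pu = v *m Pu *m iB.
Proof.
rewrite -[LHS]mulmx1 -rmatK mulmxA -proj_u_comm -(mulmxA v).
by rewrite rmatVK mulmx1.
Qed.

Lemma lam_gt0 : 0 < lam.
Proof.
have [v vE v0] : exists2 v : 'rV[R]_3, (v <= Es)%MS & v != 0.
  have : Es != 0 by rewrite -mxrank_eq0 (Es_rank HS).
  by move=> /rowV0Pn[v vE v0]; exists v.
have := Es_contracted HS vE v0; move/(le_lt_trans (enorm_ge0 _)).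
by rewrite pmulr_lgt0// enorm_gt0.
Qed.

Lemma lam3_lt1 : 3 * lam < 1.
Proof. by have := lam_lt HS; lra. Qed.

Lemma Es_contract v : enorm (v *m Ps *m B) <= lam * enorm (v *m Ps).
Proof.
have [->|v0] := eqVneq (v *m Ps) 0; first by rewrite mul0mx enorm0 mulr0.
by apply/ltW/(Es_contracted HS) => //; exact: proj_s_sub.
Qed.

Lemma Eu_contractV v : enorm (v *m Pu *m iB) <= lam * enorm (v *m Pu).
Proof.
have [->|v0] := eqVneq (v *m Pu) 0; first by rewrite mul0mx enorm0 mulr0.
by rewrite -invmx_rmat; apply/ltW/(Eu_expanded HS) => //; exact: proj_u_sub.
Qed.

(** The rate [1 / lam] is rounded down to 3, the factor of the growth estimates below. *)
Lemma Es_expandV v : 3 * enorm (v *m Ps) <= enorm (v *m iB *m Ps).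
Proof.
have := Es_contract (v *m iB); rewrite -proj_s_comm -(mulmxA v) rmatVK mulmx1.
have := lam3_lt1; have := enorm_ge0 (v *m iB *m Ps); set a := enorm _; set b := enorm _.
nra.
Qed.

Lemma Eu_expand v : 3 * enorm (v *m Pu) <= enorm (v *m B *m Pu).
Proof.
have := Eu_contractV (v *m B); rewrite -proj_u_commV -(mulmxA v) rmatK mulmx1.
have := lam3_lt1; have := enorm_ge0 (v *m B *m Pu); set a := enorm _; set b := enorm _.
nra.
Qed.

Lemma Eu_expand_iter v n : 3 ^+ n * enorm (v *m Pu) <= enorm (v *m B ^+ n *m Pu).
Proof.
elim: n => [|n IH]; first by rewrite expr0 mulmx1 mul1r.
rewrite mulmxXSr (le_trans _ (Eu_expand _))//.
by rewrite exprS -mulrA ler_pM2l.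
Qed.

Lemma Es_expandV_iter v n : 3 ^+ n * enorm (v *m Ps) <= enorm (v *m iB ^+ n *m Ps).
Proof.
elim: n => [|n IH]; first by rewrite expr0 mulmx1 mul1r.
rewrite mulmxXSr (le_trans _ (Es_expandV _))//.
by rewrite exprS -mulrA ler_pM2l.
Qed.

Lemma Eu_contractV_iter v n :
  3 ^+ n * enorm (v *m iB ^+ n *m Pu) <= enorm (v *m Pu).
Proof.
have := Eu_expand_iter (v *m iB ^+ n) n.
by rewrite (mulmxXK _ _ rmatVK).
Qed.

End AnosovLinear.

(** * The lifted semiconjugacy *)

Lemma Amap_tproj (R : realType) (S : anosov_data R) (w : 'rV[R]_3) :
  Amap S (tproj w) = tproj (w *m rmat S).
Proof.
apply/tprojP; rewrite -mulmxBl; apply: intvecM; apply/tprojP; exact: tproj_repr.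
Qed.

(** [Gi] merely selects a preimage under [G] of each point. The semiconjugacy [sl_HG] is written for
    differences, which removes the constant integer vector by which [H (G u)] and [H u *m rmat S]
    may differ. *)
Record semiconj_lift (R : realType) (S : anosov_data R) (eps : R)
    (g h : torus R -> torus R) (G Gi H : 'rV[R]_3 -> 'rV[R]_3) : Prop := {
  sl_G_cont : continuous G;
  sl_G_lift : forall u, tproj (G u) = g (tproj u);
  sl_GiK : cancel Gi G;
  sl_H_cont : continuous H;
  sl_H_lift : forall u, tproj (H u) = h (tproj u);
  sl_H_close : forall u, enorm (H u - u) < eps;
  sl_HG : forall u v, H (G u) - H (G v) = (H u - H v) *m rmat S
}.

Section SemiconjugacyLift.
Variables (R : realType) (S : anosov_data R) (HS : anosov_setting S).
Variables (eps : R) (g h : torus R -> torus R).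
Hypotheses (g_diffeo : C1_diffeo g) (gh : semiconjugacy S eps g h).
Hypothesis eps_lt : eps < 4^-1.
Implicit Types u v k : 'rV[R]_3.

(** As [eps < 1/4], exactly one lift of [h (tproj u)] lies within 1/4 of [u]. This uniqueness
    defines [H], and it yields both its continuity and its commutation with integer translations. *)
Lemma exists_semiconj_lift : exists Gi H, semiconj_lift S eps g h (tlift g) Gi H.
Proof.
have epsl := eps_lt; have [hc hsurj hclose hg] := gh.
have [Gc Gg] := tlift_lifts g_diffeo; set G := tlift g in Gc Gg *.
have close u : exists v, tproj v = h (tproj u) /\ enorm (v - u) < eps.
  have := hclose (tproj u); rewrite tdistC => /tdist_lt[v vE uv].
  by exists v; rewrite vE enormBC.
have [H HP] := choice close.
have Huniq u v : tproj v = h (tproj u) -> enorm (v - u) < 4^-1 -> v = H u.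
  move=> vE vu; have [HE Hu] := HP u; apply: subr0_eq.
  apply: intvec_lt1_eq0; first by apply/tprojP; rewrite HE.
  by have := ler_enorm_distD u v (H u); rewrite (enormBC u (H u)); lra.
have HD u k : intvec k -> H (u + k) = H u + k.
  move=> kZ; apply/esym/Huniq; first by rewrite !tprojD// (HP u).1.
  by rewrite (_ : _ - _ = H u - u); [rewrite (lt_trans (HP u).2)|vec_ring].
have Hc : continuous H.
  move=> u; apply/continuous_enormP => e e0.
  (* With both displacements below [(1/4 - eps) / 2], the lift [v] near [H u] is within 1/4 of [w],
     so it must be [H w]. *)
  pose r := Num.min e ((4^-1 - eps) / 2).
  have r0 : 0 < r by rewrite lt_min e0; lra.
  pose V := [set v : 'rV[R]_3 | enorm (v - H u) < r].
  have Vn : nbhs (h (tproj u)) (@tproj R @` V).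
    rewrite -(HP u).1; apply: filterS (nbhs_tball (tproj (H u)) r0).
    move=> y /tdist_lt[v vy Hv]; exists v => //.
    by rewrite /V/= enormBC.
  have := hc (tproj u) _ Vn; move=> /(@tproj_continuous R u) /nbhs_enormP[d d0 dV].
  apply/nbhs_enormP; exists (Num.min d ((4^-1 - eps) / 2)).
    by rewrite lt_min d0; lra.
  move=> w; rewrite lt_min => /andP[/dV[v Vv vw] wu].
  rewrite /V/= /r lt_min in Vv; have /andP[ve vr] := Vv.
  rewrite -(Huniq w v)//.
  have := ler_enorm_distD (H u) v w; have := ler_enorm_distD u (H u) w.
  by have := (HP u).2; rewrite (enormBC u w); lra.
(* The defect [H (G u) - H u *m rmat S] is continuous and integer valued, hence constant. *)
have [kap kapE] : exists kap, forall u, H (G u) = H u *m rmat S + kap.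
  exists (H (G 0) - H 0 *m rmat S) => u.
  have Fc : continuous ((H \o G) \- ((fun v => v *m rmat S) \o H)).
    move=> v; apply: continuousB.
      by apply: (@continuous_comp _ _ _ G H); [exact: Gc|exact: Hc].
    exact: (continuous_comp (Hc v) (@mulmxr_continuous R (rmat S) (H v))).
  have FZ v : intvec (H (G v) - H v *m rmat S).
    by apply/tprojP; rewrite (HP _).1 Gg hg -(HP v).1 Amap_tproj.
  by have /= <- := continuous_intvec_cst Fc FZ u; vec_ring.
(* Comparing [kapE] at [u + k] and at [u] shows that the translation vector [l] of [G] is
   [k *m rmat S]. *)
have GD u k : intvec k -> G (u + k) = G u + k *m rmat S.
  move=> kZ; have [l lZ lE] := lifts_translate (tlift_lifts g_diffeo) kZ.
  have := kapE (u + k); rewrite -/G in lE; rewrite lE !HD// kapE mulmxDl => E.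
  by congr (_ + _); apply: (addrI (H u *m rmat S + kap)); rewrite E; vec_ring.
have [gbij _] := g_diffeo.
have Gsurj v : exists u, G u = v.
  have [gi giK gKi] := gbij.
  pose w : 'rV[R]_3 := repr (gi (tproj v)).
  have kZ : intvec (v - G w).
    by apply/tprojP; rewrite Gg tproj_repr gKi.
  (* [G w] misses [v] by a lattice vector; the error is corrected by translating [w] by the preimage
     of this vector under [rmat]. *)
  exists (w + (v - G w) *m map_mx intr (invmx (amat S))).
  rewrite GD; last exact: intvecM.
  by rewrite -mulmxA rmatVK// mulmx1; vec_ring.
have [Gi GiP] := choice Gsurj.
exists Gi, H; split => //.
- by move=> u; exact: (HP u).1.
- by move=> u; exact: (HP u).2.
- by move=> u v; rewrite !kapE mulmxBl; vec_ring.
Qed.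

End SemiconjugacyLift.

Section SemiconjugacyIterates.
Variables (R : realType) (S : anosov_data R) (HS : anosov_setting S).
Variables (eps : R) (g h : torus R -> torus R) (G Gi H : 'rV[R]_3 -> 'rV[R]_3).
Hypothesis gh : semiconj_lift S eps g h G Gi H.
Implicit Types u v : 'rV[R]_3.

Local Notation iB := (map_mx intr (invmx (amat S)) : 'M[R]_3).

Lemma tproj_iterG u n : tproj (iter n G u) = iter n g (tproj u).
Proof. by elim: n => //= n <-; rewrite (sl_G_lift gh). Qed.

Lemma iterGiK u n : iter n G (iter n Gi u) = u.
Proof. by elim: n u => //= n IH u; rewrite -iterS iterSr (sl_GiK gh). Qed.

Lemma iterG_cont n : continuous (iter n G).
Proof.
elim: n => [|n IH] u; first exact: cvg_id.
by apply: (@continuous_comp _ _ _ (iter n G) G); [exact: IH|exact: sl_G_cont gh _].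
Qed.

Lemma H_iterG u v n :
  H (iter n G u) - H (iter n G v) = (H u - H v) *m rmat S ^+ n.
Proof.
by elim: n => [|n IH]; [rewrite mulmx1|rewrite !iterS (sl_HG gh) IH mulmxXSr].
Qed.

Lemma H_iterGi u v n :
  H (iter n Gi u) - H (iter n Gi v) = (H u - H v) *m iB ^+ n.
Proof.
rewrite -[in RHS](iterGiK u n) -[in RHS](iterGiK v n) H_iterG.
by rewrite mulmxXK// rmatK.
Qed.

End SemiconjugacyIterates.

(** * Curves and their length *)

Lemma derive1_curve_comp (K : numFieldType) (m n : nat) (gam : K -> 'rV[K]_m.+1)
    (F : 'rV[K]_m.+1 -> 'rV[K]_n.+1) (t : K) :
  derivable gam t 1 -> differentiable F (gam t) ->
  derivable (F \o gam) t 1 /\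
  derive1 (F \o gam) t = derive1 gam t *m 'J F (gam t).
Proof.
move=> /derivable1_diffP dgam dF.
have dFg : differentiable (F \o gam) t by exact: differentiable_comp.
split; first exact/derivable1_diffP.
rewrite (derive1E' dFg) (derive1E' dgam).
apply: etrans (deriveEjacobian ('d gam t 1) dF).
by rewrite (deriveE _ dF) (diff_comp dgam dF).
Qed.

Lemma derive1_reparam (K : numFieldType) (V : normedModType K) (gam : K -> V) (a t : K) :
  derivable gam (a * t) 1 ->
  derivable (fun s => gam (a * s)) t 1 /\
  derive1 (fun s => gam (a * s)) t = a *: derive1 gam (a * t).
Proof.
move=> /derivable1_diffP dgam.
have da : is_derive t (1 : K) ( *%R a) a.
  have := @is_deriveZ _ _ _ id a t 1 1 (is_derive_id t 1).
  by rewrite /GRing.scale/= mulr1.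
have dfa : differentiable ( *%R a) t by apply/derivable1_diffP; exact: ex_derive.
have dga : differentiable (gam \o ( *%R a)) t by exact: differentiable_comp.
split; first exact/derivable1_diffP.
have E1 := diff_comp dfa dgam.
have := derive1E' dfa; rewrite derive1E derive_val => E2.
have E3 := derive1E' dga.
have E4 := derive1E' dgam.
have E5 : 'd gam (a * t) (a *: (1 : K^o)) = a *: 'd gam (a * t) 1 by exact: linearZ.
rewrite [a *: (1 : K^o)]mulr1 in E5.
rewrite E4 -E5 [X in 'd gam _ X]E2.
exact: etrans E3 (congr1 (fun f => f 1) E1).
Qed.

Section Curves.
Variable R : realType.
Implicit Types (gam : R -> 'rV[R]_3) (u v w : 'rV[R]_3) (F : R -> R).

Lemma edot_continuous w : continuous (fun v => edot v w).
Proof.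
move=> v; have vF := nbhs_filter v.
apply/(@cvgrPdist_lt _ _ _ _ vF) => e e0; apply/nbhs_enormP.
exists (e / (enorm w + 1)); first by rewrite divr_gt0// ltr_wpDl// enorm_ge0.
move=> u uv.
have dE : edot v w - edot u w = edot (v - u) w by rewrite !edotE !mxE; ring.
have w0 := enorm_ge0 w.
have H : enorm (v - u) * enorm w < e.
  move: uv; rewrite enormBC ltr_pdivlMr ?ltr_wpDl// => uv.
  by apply: le_lt_trans uv; rewrite ler_wpM2l ?enorm_ge0// lerDl.
rewrite dE ltr_norml (le_lt_trans (edot_le _ _) H) andbT ltrNl.
have -> : - edot (v - u) w = edot (u - v) w by rewrite !edotE !mxE; ring.
by rewrite (le_lt_trans (edot_le _ _))// enormBC.
Qed.

Lemma is_derive_edot gam w t : derivable gam t 1 ->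
  is_derive t 1 (fun s => edot (gam s) w) (edot (derive1 gam t) w).
Proof.
move=> dgam.
have cv : (fun h : R => h^-1 *: (((fun s => edot (gam s) w) \o shift t) (h *: 1)
      - edot (gam t) w))
    @ 0^' --> edot (derive1 gam t) w.
  rewrite (_ : (fun h : R => _) = (fun v => edot v w) \o
     (fun h : R => h^-1 *: ((gam \o shift t) (h *: 1) - gam t))).
    rewrite derive1E; apply: continuous_cvg; last exact: dgam.
    exact: edot_continuous.
  by apply/funext => h; rewrite /= !edotE !mxE /GRing.scale/=; ring.
split; first by apply/cvg_ex; exists (edot (derive1 gam t) w).
exact: cvg_lim cv.
Qed.

Lemma is_derive_le (f g df dg : R -> R) (a b : R) : a <= b ->
  (forall x, a <= x <= b -> is_derive x 1 f (df x)) ->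
  (forall x, a <= x <= b -> is_derive x 1 g (dg x)) ->
  (forall x, a < x < b -> df x <= dg x) ->
  f b - f a <= g b - g a.
Proof.
rewrite le_eqVlt => /predU1P[->|ab] fd gd dfg; first by rewrite !subrr.
have d x : a <= x <= b -> is_derive x 1 (g - f) (dg x - df x).
  by move=> xab; apply: is_deriveB; [exact: gd|exact: fd].
have [||c cab] := @MVT _ (g - f) (fun x => dg x - df x) a b ab.
- by move=> x; rewrite in_itv/= => /andP[/ltW ax /ltW xb]; apply: d; rewrite ax.
- apply: derivable_within_continuous => x; rewrite in_itv/= => xab.
  by have := d _ xab => ?; exact: ex_derive.
have := dfg c; move: cab; rewrite in_itv/= => cab /(_ cab) dc.
rewrite !fctE => E; have : 0 <= (dg c - df c) * (b - a).
  by rewrite mulr_ge0// subr_ge0// ltW.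
by rewrite -E; lra.
Qed.

Lemma continuous_antiderivative (phi : R -> R) : continuous phi ->
  exists F, forall x : R, 0 <= x <= 1 -> is_derive x 1 F (phi x).
Proof.
move=> phic.
(* Integrating from -1, with integrability on [[-1, 2]], makes 0 and 1 interior points, so that the
   derivatives there are two-sided. *)
exists (fun x => \int[lebesgue_measure]_(t in `[-1, x]) phi t) => x /andP[x0 x1].
have phiI : lebesgue_measure.-integrable `[-1, 2] (EFin \o phi).
  apply: continuous_compact_integrable; first exact: segment_compact.
  exact: continuous_subspaceT.
have x2 : x < 2 by lra.
have xN1 : -1 < x by lra.
have [d dE] := @continuous_FTC1_closed R phi (-1) x 2 x2 phiI xN1 (phic x).
by apply: DeriveDef d _; rewrite -derive1E; exact: dE.
Qed.

Lemma Rintegral_FTC2 F (phi : R -> R) : continuous phi ->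
  (forall x : R, 0 <= x <= 1 -> is_derive x 1 F (phi x)) ->
  \int[lebesgue_measure]_(t in `[0, 1]) phi t = F 1 - F 0.
Proof.
move=> phic Fd; have dF x : 0 <= x <= 1 -> derivable F x 1.
  by move=> /Fd ?; exact: ex_derive.
have Fc x : 0 <= x <= 1 -> {for x, continuous F}.
  by move=> /dF/derivable1_diffP; exact: differentiable_continuous.
rewrite /Rintegral (@continuous_FTC2 _ _ F) ?ltr01//.
- exact: continuous_subspaceT.
- split.
  + by move=> x; rewrite in_itv/= => /andP[x0 x1]; apply: dF; rewrite !ltW.
  + by apply: cvg_at_right_filter; apply: Fc; rewrite lexx ler01.
  + by apply: cvg_at_left_filter; apply: Fc; rewrite lexx ler01.
- move=> x; rewrite in_itv/= => /andP[x0 x1].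
  have := Fd x; rewrite !ltW// => /(_ isT) ?.
  by rewrite derive1E; exact: derive_val.
Qed.

Lemma enorm_derive1_continuous gam :
  C1_curve gam -> continuous (fun t => enorm (derive1 gam t)).
Proof.
by move=> [_ gc] t; apply: continuous_comp; [exact: gc|exact: enorm_continuous].
Qed.

Lemma curve_length_primitive gam (a : R) F : C1_curve gam -> 0 <= a <= 1 ->
  (forall x : R, 0 <= x <= 1 -> is_derive x 1 F (enorm (derive1 gam x))) ->
  C1_curve (fun t => gam (a * t)) /\
  curve_length (fun t => gam (a * t)) = F a - F 0.
Proof.
move=> gC /andP[a0 a1] Fd; have [gd gc] := gC.
have rd t := derive1_reparam (gd (a * t)).
have dE : derive1 (fun t => gam (a * t)) = fun t => a *: derive1 gam (a * t).
  by apply/funext => t; exact: (rd t).2.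
have ac : continuous (fun t : R => a * t) by exact: mulrl_continuous.
have rC : C1_curve (fun t => gam (a * t)).
  split; first by move=> t; exact: (rd t).1.
  rewrite dE => t; apply: cvgZr.
  exact: (@continuous_comp _ _ _ (fun t => a * t) (derive1 gam) t (ac t) (gc (a * t))).
split; first exact: rC.
have Hd (x : R) : 0 <= x <= 1 ->
    is_derive x 1 (fun t => F (a * t)) (enorm (derive1 (fun t => gam (a * t)) x)).
  move=> /andP[x0 x1]; rewrite dE enormZ (ger0_norm a0) mulrC.
  apply: (@is_derive1_comp _ F ( *%R a)).
    by apply: Fd; rewrite mulr_ge0// mulr_ile1.
  have := @is_deriveZ _ _ _ id a x 1 1 (is_derive_id x 1).
  by rewrite /GRing.scale/= mulr1.
have := Rintegral_FTC2 (enorm_derive1_continuous rC) Hd.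
by rewrite mulr1 mulr0.
Qed.

Lemma exists_arclength gam : C1_curve gam -> exists F,
  (forall x : R, 0 <= x <= 1 -> is_derive x 1 F (enorm (derive1 gam x))) /\
  curve_length gam = F 1 - F 0.
Proof.
move=> gC; have [F Fd] := continuous_antiderivative (enorm_derive1_continuous gC).
exists F; split; first exact: Fd.
exact: Rintegral_FTC2 (enorm_derive1_continuous gC) Fd.
Qed.

Lemma curve_length_le (c : R) gam gam' : C1_curve gam -> C1_curve gam' ->
  (forall t, 0 < t < 1 -> enorm (derive1 gam t) <= c * enorm (derive1 gam' t)) ->
  curve_length gam <= c * curve_length gam'.
Proof.
move=> gC gC' le; have [F [Fd ->]] := exists_arclength gC.
have [F' [Fd' ->]] := exists_arclength gC'.
rewrite mulrBr; apply: (@is_derive_le F (fun t => c * F' t) _ _ 0 1 ler01 Fd _ le).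
by move=> x x01; have := @is_deriveZ _ _ _ F' c x 1 _ (Fd' x x01).
Qed.

(** The scalar product of the curve with its chord [w] grows by [enorm w ^+ 2], while by
    Cauchy-Schwarz its derivative is at most [enorm w] times the speed. *)
Lemma enorm_le_curve_length gam t : C1_curve gam -> 0 <= t <= 1 ->
  enorm (gam t - gam 0) <= curve_length gam.
Proof.
move=> gC /andP[t0 t1]; have [F [Fd ->]] := exists_arclength gC.
have [->|gt0] := eqVneq (gam t - gam 0) 0.
  rewrite enorm0.
  have := @is_derive_le (cst 0) F (cst 0) _ 0 1 ler01 (fun x _ => is_derive_cst 0 x 1) Fd
    (fun x _ => enorm_ge0 _).
  by rewrite /= subrr.
set w := gam t - gam 0 in gt0 *.
have le1 : edot (gam t) w - edot (gam 0) w <= enorm w * (F t - F 0).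
  rewrite mulrBr; apply: (@is_derive_le (fun s => edot (gam s) w) (fun s => enorm w * F s)
    (fun s => edot (derive1 gam s) w) (fun s => enorm w * enorm (derive1 gam s)) 0 t t0).
  - by move=> x _; apply: is_derive_edot; exact: gC.1.
  - move=> x /andP[x0 xt]; have := @is_deriveZ _ _ _ F (enorm w) x 1 _ (Fd x _).
    by apply; rewrite x0 (le_trans xt).
  - by move=> x _; rewrite mulrC edot_le.
have le2 : F t <= F 1.
  have Fdt (x : R) : t <= x <= 1 -> is_derive x 1 F (enorm (derive1 gam x)).
    by move=> /andP[tx x1]; apply: Fd; rewrite (le_trans t0).
  have := @is_derive_le (cst 0) F (cst 0) _ t 1 t1 (fun x _ => is_derive_cst 0 x 1) Fdt
    (fun x _ => enorm_ge0 _).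
  by rewrite /= subrr subr_ge0.
have wE : edot (gam t) w - edot (gam 0) w = enorm w ^+ 2.
  by rewrite -edotvv {3}/w !edotE !mxE; ring.
move: le1; rewrite wE expr2 ler_pM2l ?enorm_gt0// => le1.
by rewrite (le_trans le1)// lerB.
Qed.

(** The intermediate value theorem applied to the arclength function [F]. *)
Lemma exists_subcurve gam (L : R) : C1_curve gam -> 0 <= L <= curve_length gam ->
  exists2 a, 0 <= a <= 1 &
    C1_curve (fun t => gam (a * t)) /\ curve_length (fun t => gam (a * t)) = L.
Proof.
move=> gC /andP[L0]; have [F [Fd ->]] := exists_arclength gC => LF.
have Fc : {within `[0, 1], continuous F}.
  apply: derivable_within_continuous => x; rewrite in_itv/= => x01.
  by have := Fd x x01 => ?; exact: ex_derive.
have [|a] := @IVT _ F 0 1 (F 0 + L) ler01 Fc.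
  by rewrite ge_min le_max; apply/andP; split; apply/orP; [left|right]; lra.
rewrite in_itv/= => a01 FaE; exists a; first exact: a01.
have [gaC ->] := curve_length_primitive gC a01 Fd.
by split; [exact: gaC|rewrite FaE; ring].
Qed.

Lemma segment_C1 u v : C1_curve (fun t => u + t *: v) /\
  forall t, derive1 (fun t : R => u + t *: v) t = v.
Proof.
have d t : is_derive t (1 : R) (fun t : R => u + t *: v) v.
  have cv : (fun h : R => h^-1 *: (((fun t : R => u + t *: v) \o shift t) (h *: 1)
      - (u + t *: v)))
    @ 0^' --> v.
    apply: (@cvg_trans _ ((fun=> v) @ 0^')); last exact: cvg_cst.
    apply: near_eq_cvg; near=> h => /=.
    rewrite (_ : _ - _ = h *: v).
      rewrite scalerA mulVf ?scale1r//.
      by near: h; exact: nbhs_dnbhs_neq.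
    by apply/rowP => i; rewrite !mxE /GRing.scale/=; ring.
  split; first by apply/cvg_ex; exists v.
  exact: cvg_lim cv.
have dE t : derive1 (fun t : R => u + t *: v) t = v.
  by rewrite derive1E; have := d t => ?; exact: derive_val.
split; last exact: dE.
split=> [t|]; first by have := d t => ?; exact: ex_derive.
by rewrite (_ : derive1 _ = cst v); [exact: cst_continuous|exact/funext].
Unshelve. all: by end_near.
Qed.

Lemma continuous_mulmx (v : R -> 'rV[R]_3) (M : R -> 'M[R]_3) :
  continuous v -> continuous M -> continuous (fun t => v t *m M t).
Proof.
move=> vc Mc t; apply/continuous_enormP => e e0.
have e4 : 0 < e / 4 by rewrite divr_gt0.
have cc i : (v s *m M s) 0 i @[s --> t] --> (v t *m M t) 0 i.
  have E s : (v s *m M s) 0 i =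
      v s 0 0 * M s 0 i + v s 0 1 * M s 1 i + v s 0 2%:R * M s 2%:R i.
    rewrite mxE !big_ord_recr big_ord0 /= add0r.
    by congr (v s _ _ * M s _ _ + v s _ _ * M s _ _ + v s _ _ * M s _ _); exact: val_inj.
  have cv j : v s 0 j @[s --> t] --> v t 0 j.
    exact: (@continuous_comp _ _ _ v (fun w : 'rV[R]_3 => w 0 j) t (vc t)
      (@coord_continuous _ _ _ 0 j (v t))).
  have cM j : M s j i @[s --> t] --> M t j i.
    exact: (@continuous_comp _ _ _ M (fun w : 'M[R]_3 => w j i) t (Mc t)
      (@coord_continuous _ _ _ j i (M t))).
  rewrite E (_ : (fun s => (v s *m M s) 0 i) = (fun s =>
      v s 0 0 * M s 0 i + v s 0 1 * M s 1 i + v s 0 2%:R * M s 2%:R i)).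
    by apply: cvgD; [apply: cvgD|]; apply: cvgM.
  exact/funext.
have near_i i : \forall s \near t, `|(v s *m M s - v t *m M t) 0 i| < e / 4.
  have /cvgrPdist_lt/(_ _ e4) := cc i.
  by apply: filterS => s; rewrite distrC !mxE.
have : \forall s \near t, forall i, `|(v s *m M s - v t *m M t) 0 i| < e / 4.
  exact: (@filter_forall _ _
    (fun i s => `|(v s *m M s - v t *m M t) 0 i| < e / 4) _ (nbhs_filter t) near_i).
apply: filterS => s H; apply: (@le_lt_trans _ _ (3 * (e / 4))); last by lra.
by apply: enorm_le_coord => i; apply/ltW.
Qed.

Lemma C1_curve_comp (G : 'rV[R]_3 -> 'rV[R]_3) gam :
  C1_map G -> C1_curve gam -> C1_curve (G \o gam) /\
  forall t, derive1 (G \o gam) t = derive1 gam t *m 'J G (gam t).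
Proof.
move=> [Gd Gc] [gd gc]; have d t := derive1_curve_comp (gd t) (Gd (gam t)).
split; last by move=> t; exact: (d t).2.
split; first by move=> t; exact: (d t).1.
rewrite (_ : derive1 (G \o gam) = fun t => derive1 gam t *m 'J G (gam t)); last first.
  by apply/funext => t; exact: (d t).2.
apply: continuous_mulmx; first exact: gc.
move=> t.
apply: (@continuous_comp _ _ _ gam (fun x => 'J G x : 'M[R]_3)); last exact: Gc.
by apply: differentiable_continuous; apply/derivable1_diffP; exact: gd.
Qed.

End Curves.

(** * Leaves *)

Lemma is_derive_curve_comp (K : numFieldType) (m n : nat) (gam : K -> 'rV[K]_m.+1)
    (F : 'rV[K]_m.+1 -> 'rV[K]_n.+1) (t : K) d :
  is_derive t 1 gam d -> differentiable F (gam t) ->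
  is_derive t 1 (F \o gam) (d *m 'J F (gam t)).
Proof.
move=> gd dF; have [Fg E] := derive1_curve_comp (@ex_derive _ _ _ _ _ _ _ gd) dF.
apply: DeriveDef Fg _; rewrite -derive1E; apply: etrans E _.
by rewrite derive1E; congr (_ *m _); exact: derive_val.
Qed.

Lemma is_derive_mulmxr (K : realFieldType) (m n : nat) (f : K -> 'rV[K]_m)
    (M : 'M[K]_(m, n)) (t : K) d :
  is_derive t 1 f d -> is_derive t 1 (fun s => f s *m M) (d *m M).
Proof.
move=> fd; have fdij i j : is_derive t 1 (fun s => (f s *m M) i j) ((d *m M) i j).
  rewrite (_ : (fun s => _) = \sum_k (M k j \*: (fun s => f s i k))); last first.
    apply/funext => s; rewrite mxE fct_sumE; apply: eq_bigr => k _.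
    by rewrite mulrC.
  rewrite (_ : (d *m M) i j = \sum_k M k j *: d i k); last first.
    by rewrite mxE; apply: eq_bigr => k _; rewrite mulrC.
  apply: is_derive_sum => k; apply: is_deriveZ.
  have fdd := @ex_derive _ _ _ _ _ _ _ fd.
  apply: DeriveDef ((derivable_mxP f t 1).1 fdd i k) _.
  have <- := @derive_val _ _ _ _ _ _ _ fd.
  by rewrite (derive_mx fdd) mxE.
have fM : derivable (fun s => f s *m M) t 1.
  by apply/derivable_mxP => i j; exact: (@ex_derive _ _ _ _ _ _ _ (fdij i j)).
apply: DeriveDef (fM) _; rewrite (derive_mx fM).
by apply/matrixP => i j; rewrite mxE; exact: (@derive_val _ _ _ _ _ _ _ (fdij i j)).
Qed.

Section Leaves.
Variables (R : realType) (S : anosov_data R) (HS : anosov_setting S).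
Variables (kappa : R) (leaf : 'rV[R]_3 -> set 'rV[R]_3) (E : torus R -> 'M[R]_3).
Hypothesis leafC : C1_close_foliation (Es S) (Eu S) kappa leaf E.
Implicit Types (z w : 'rV[R]_3) (gam : R -> 'rV[R]_3) (t : R).

Lemma leaf_proj_u z w : leaf z w -> enorm ((w - z) *m proj_u S) < kappa.
Proof.
have [_ _ _ /(_ z)[phi /= [_ _ -> phis _]]] := leafC; move=> [s _ <-].
rewrite (_ : _ - z = s *m Es S + phi s *m Eu S); last by vec_ring.
rewrite mulmxDl proj_u0 ?submxMl// add0r (proj_u_id HS) ?submxMl//.
exact: (phis s).1.
Qed.

(** The curve is the graph over its own parameter [sig]. Differentiating this identity expresses the
    velocity through the rows of [Es + 'J phi *m Eu], which span the plane [E]. *)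
Lemma leaf_tangent z gam t d : (forall s, 0 <= s <= 1 -> leaf z (gam s)) ->
  0 < t < 1 -> is_derive t 1 gam d -> (d <= E (tproj (gam t)))%MS.
Proof.
move=> gleaf /andP[t0 t1] gd.
have [_ _ _ /(_ z)[phi [phiC _ lE _ phiE]]] := leafC.
(* [N] is the linear map that reads the parameter [s] off [s *m Es S + x *m Eu S]. *)
pose N : 'M[R]_(3, 2) := proj_s S *m pinvmx (Es S).
have NE (s : 'rV[R]_2) x : (s *m Es S + x *m Eu S) *m N = s.
  rewrite /N mulmxA mulmxDl (proj_s_id HS) ?submxMl//.
  rewrite (proj_s0 HS) ?submxMl// addr0 mulmxKp//.
  by rewrite /row_free (Es_rank HS).
pose sig s := gam s *m N - z *m N.
pose rhs s := z + sig s *m Es S + phi (sig s) *m Eu S.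
have rhsE s : 0 <= s <= 1 -> gam s = rhs s.
  move=> /gleaf; rewrite lE => -[r _ rE].
  suff -> : rhs s = z + r *m Es S + phi r *m Eu S by rewrite rE.
  suff sr : sig s = r by rewrite /rhs sr.
  rewrite /sig -rE -mulmxBl -[RHS](NE r (phi r)); congr (_ *m _).
  by vec_ring.
have sigd : is_derive t 1 sig (d *m N).
  rewrite -[d *m N]subr0; apply: is_deriveB; exact: is_derive_mulmxr.
have phid := is_derive_curve_comp sigd (phiC.1 (sig t)).
have rhsd : is_derive t 1 rhs (d *m N *m Es S + d *m N *m 'J phi (sig t) *m Eu S).
  rewrite -[X in X + _]add0r; apply: is_deriveD; last exact: is_derive_mulmxr.
  by apply: is_deriveD; exact: is_derive_mulmxr.
have dE : d = d *m N *m Es S + d *m N *m 'J phi (sig t) *m Eu S.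
  apply: etrans (esym (@derive_val _ _ _ _ _ _ _ gd)) _.
  apply: etrans (@derive_val _ _ _ _ _ _ _ rhsd).
  (* Since [t] is interior to the unit interval, the curve and its graph expression agree on a
     neighbourhood of [t]. *)
  apply: near_eq_derive.
  near=> s; apply: rhsE; apply/andP; split; near: s.
    exact: lt_le_nbhsr.
  exact: lt_le_nbhsl.
have t01 : 0 <= t <= 1 by rewrite !ltW.
rewrite dE (rhsE _ t01); have /andP[EE _] := phiE (sig t).
apply: submx_trans EE.
by rewrite -(mulmxA (d *m N)) -mulmxDr submxMl.
Unshelve. all: by end_near.
Qed.

End Leaves.

(** * Iterates of curves and discs *)

Section CurveDynamics.
Variables (R : realType) (S : anosov_data R) (HS : anosov_setting S).
Variable g : torus R -> torus R.
Hypothesis g_diffeo : C1_diffeo g.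
Implicit Types (u z w : 'rV[R]_3) (gam : R -> 'rV[R]_3) (t : R).

Local Notation G := (tlift g).

Lemma C1_curve_tlift gam : C1_curve gam -> C1_curve (G \o gam) /\
  forall t, derive1 (G \o gam) t = derive1 gam t *m tderiv g (tproj (gam t)).
Proof.
move=> gC; have [GgC GgE] := C1_curve_comp (tlift_C1 g_diffeo).1 gC.
split; first exact: GgC.
move=> t; apply: etrans (GgE t) _.
exact: (congr1 (mulmx (derive1 gam t)) (esym (tderivE g_diffeo (gam t)))).
Qed.

Lemma tderiv_unit x : tderiv g x \in unitmx.
Proof.
rewrite -(tproj_repr x) (tderivE g_diffeo); exact: (tlift_C1 g_diffeo).2.
Qed.

Lemma exists_exp3_ge (x : R) : exists n, x <= 3 ^+ n.
Proof.
exists (Num.bound `|x|); apply: (le_trans (ler_norm x)).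
apply: (le_trans (ltW (archi_boundP (normr_ge0 x)))).
by rewrite -natrX ler_nat; apply/ltnW/ltn_expl.
Qed.

Section Unstable.
Hypotheses (g_inv : cone_invariance S g) (g_exp : cone_expansion S g).

(** Growth is recorded as a pointwise lower bound [c] on the speed, a form that can be iterated. *)
Lemma tangent_curve_tlift gam (c : R) : tangent_curve (Cu S) gam ->
  (forall t, 0 <= t <= 1 -> c <= enorm (derive1 gam t)) ->
  tangent_curve (Cu S) (G \o gam) /\
  (forall t, 0 <= t <= 1 -> 3 * c <= enorm (derive1 (G \o gam) t)).
Proof.
move=> [gC gT] gc; have [GgC GgE] := C1_curve_tlift gC.
have [_ Gl] := tlift_lifts g_diffeo.
have key t : 0 <= t <= 1 ->
   [/\ derive1 (G \o gam) t != 0, Cu S (tproj (G (gam t))) (derive1 (G \o gam) t) &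
    3 * c <= enorm (derive1 (G \o gam) t)].
  move=> t01; have [v0 vC] := gT t t01; have := gc t t01.
  rewrite (GgE t); set v := derive1 gam t in v0 vC *.
  set M := tderiv g (tproj (gam t)) => cv.
  have MU : M \in unitmx by exact: tderiv_unit.
  have vM0 : v *m M != 0.
    by apply: contra_neq v0 => vM; rewrite -(mulmxK MU v) vM mul0mx.
  have CvM : Cu S (tproj (G (gam t))) (v *m M).
    by apply: interior_subset; rewrite Gl; exact: g_inv.
  split=> //; have := g_exp (x := tproj (gam t)) (w := v *m M).
  rewrite -Gl => /(_ CvM vM0); rewrite -/M mulmxK// => lt.
  have := lam3_lt1 HS; have := lam_gt0 HS; have := enorm_ge0 (v *m M).
  by nra.
split; last by move=> t /key[].
by split; [exact: GgC|move=> t /key[]].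
Qed.

(** A short segment in the direction [Eu] inside [U] is iterated: its images stay in [U] and tangent
    to the cones, and their speed triples, until one of them contains a curve of length exactly
    [Lu S]. *)
Lemma trapping_hits_discs U (D : set (torus R)) : trapping g U -> U !=set0 ->
  (forall gam, tangent_curve (Cu S) gam -> curve_length gam = Lu S ->
    hits_disc gam D) ->
  exists2 x, U x & D (g x).
Proof.
move=> [Uo gU] [x0 Ux0] hits.
have [_ Gl] := tlift_lifts g_diffeo.
have Un : nbhs (repr x0) (@tproj R @^-1` U).
  apply: tproj_continuous; rewrite -/(tproj _) tproj_repr.
  exact: open_nbhs_nbhs.
have /nbhs_enormP[e e0 eU] := Un; set u0 : 'rV[R]_3 := repr x0 in eU.
have Eu0 : 0 < enorm (Eu S).
  by rewrite enorm_gt0 -mxrank_eq0 (Eu_rank HS).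
(* The length [e / 2] keeps the whole segment in the ball of radius [e] that projects into [U]. *)
pose v0 := (e / 2 / enorm (Eu S)) *: Eu S.
have v0E : enorm v0 = e / 2.
  by rewrite enormZ gtr0_norm ?divr_gt0// divfK// gt_eqF.
have v00 : 0 < enorm v0 by rewrite v0E divr_gt0.
pose gam0 t := u0 + t *: v0.
have [g0C g0d] := segment_C1 u0 v0.
have v0C x : Cu S x v0.
  exists v0, 0; rewrite addr0 enorm0; split=> //.
  - by rewrite scalemx_sub.
  - exact: sub0mx.
  - by rewrite mulr_ge0 ?enorm_ge0// ltW// (cone_u_gt0 HS).
have gU0 t : 0 <= t <= 1 -> U (tproj (gam0 t)).
  move=> /andP[t0 t1]; apply: eU.
  rewrite (_ : _ - u0 = t *: v0); last by rewrite /gam0; vec_ring.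
  rewrite enormZ v0E ger0_norm//.
  have : t * (e / 2) <= 1 * (e / 2) by rewrite ler_pM2r// divr_gt0.
  by lra.
have iterP n : [/\ tangent_curve (Cu S) (iter n G \o gam0),
   forall t, 0 <= t <= 1 -> 3 ^+ n * enorm v0 <= enorm (derive1 (iter n G \o gam0) t) &
   forall t, 0 <= t <= 1 -> U (tproj (iter n G (gam0 t)))].
  elim: n => [|n [IHT IHd IHU]].
    split; [split|..].
    - exact: g0C.
    - move=> t _; have -> : derive1 (iter 0 G \o gam0) t = v0 by exact: g0d.
      by split; [rewrite -enorm_gt0|exact: v0C].
    - move=> t _; have -> : derive1 (iter 0 G \o gam0) t = v0 by exact: g0d.
      by rewrite mul1r.
    - exact: gU0.
  have [GT Gd] := tangent_curve_tlift IHT IHd.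
  split; first exact: GT.
  - by move=> t t01; rewrite exprS -mulrA; exact: Gd.
  - move=> t t01; rewrite iterS Gl; apply: gU; exists (tproj (iter n G (gam0 t))) => //.
    by apply: subset_closure; exact: IHU.
have [n nL] := exists_exp3_ge (Lu S / enorm v0).
rewrite ler_pdivrMr// in nL.
(* The curve that meets the disc is iterate [n.+1]; iterate [n] lies in [U] and supplies the point
   [x] with [g x] in the disc. *)
have [nT nd _] := iterP n.+1; have [_ _ nU] := iterP n.
have len0 : enorm v0 <= curve_length gam0.
  rewrite (_ : v0 = gam0 1 - gam0 0); last by rewrite /gam0; vec_ring.
  by apply: enorm_le_curve_length; rewrite ?ler01 ?lexx.
have lenn : Lu S <= curve_length (iter n.+1 G \o gam0).
  have c0 : 0 < 3 ^+ n.+1 :> R by exact: exprn_gt0.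
  have le t : 0 < t < 1 -> enorm (derive1 gam0 t) <=
      (3 ^+ n.+1)^-1 * enorm (derive1 (iter n.+1 G \o gam0) t).
    move=> /andP[t0 t1]; have -> : derive1 gam0 t = v0 by exact: g0d.
    by rewrite ler_pdivlMl//; apply: nd; rewrite !ltW.
  have := curve_length_le g0C nT.1 le.
  move: (curve_length gam0) len0 (curve_length (_ \o _)) => l0 len0 l1.
  rewrite ler_pdivlMl// => ll; apply: le_trans ll; apply: (le_trans nL).
  rewrite exprS -mulrA; apply: (@le_trans _ _ (3 ^+ n * l0)).
    by rewrite ler_pM2l ?exprn_gt0.
  have q0 : 0 <= 3 ^+ n * l0 by rewrite mulr_ge0 ?exprn_ge0// (le_trans (ltW v00)).
  by move: (3 ^+ n * l0) q0 => q q0; lra.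
have [|a /andP[a0 a1] [aC aL]] := exists_subcurve nT.1 (L := Lu S).
  by rewrite lenn (ltW (Lu_gt0 HS)).
(* If [a] were 0, the subcurve would be constant, whereas its length is [Lu S > 0]; positivity keeps
   the rescaled velocity nonzero. *)
have a_gt0 : 0 < a.
  rewrite lt_def a0 andbT; apply/eqP => aE.
  have := @curve_length_le _ 0 _ _ aC aC.
  rewrite aL mul0r leNgt (Lu_gt0 HS) => /(_ _)/negP.
  apply=> // t _; rewrite (derive1_reparam (nT.1.1 _)).2 aE scale0r enorm0.
  by rewrite mul0r.
have at01 t : 0 <= t <= 1 -> 0 <= a * t <= 1.
  by move=> /andP[t0 t1]; rewrite mulr_ge0//= mulr_ile1.
have [|t t01 Dt] := hits _ _ aL.
  split; first exact: aC.
  move=> t /at01 at1; rewrite (derive1_reparam (nT.1.1 _)).2.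
  have [d0 dC] := nT.2 _ at1; split; first by rewrite scaler_eq0 negb_or d0 gt_eqF.
  have [e1 [f1 [e1E f1E dE ef]]] := dC.
  exists (a *: e1), (a *: f1); split; rewrite ?scalemx_sub//.
    by rewrite dE scalerDr.
  by rewrite !enormZ mulrCA ler_wpM2l.
exists (tproj (iter n G (gam0 (a * t)))); first exact/nU/at01.
by rewrite -Gl.
Qed.

End Unstable.

End CurveDynamics.

Section DiscDynamics.
Variables (R : realType) (S : anosov_data R) (HS : anosov_setting S).
Variables (g : torus R -> torus R) (g_diffeo : C1_diffeo g).
Variables (kappa beta : R) (leaf : 'rV[R]_3 -> set 'rV[R]_3) (E : torus R -> 'M[R]_3).
Hypothesis leafC : C1_close_foliation (Es S) (Eu S) kappa leaf E.
Hypothesis leaf_inv : preserves_foliation g leaf.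
Hypothesis E_cs : forall x (v : 'rV[R]_3), (v <= E x)%MS -> Ccs S x v.
Hypothesis g_cs : cs_contraction S beta g.
Implicit Types (u z w c : 'rV[R]_3) (t : R).

Local Notation G := (tlift g).

Definition far_from_pq r z := forall c,
  tproj c = fix_p S \/ tproj c = fix_q S -> r <= enorm (z - c).

Lemma far_notin_V1W1 z w : far_from_pq (3 * delta S) z ->
  enorm (w - z) < 2 * delta S -> ~ (V1 S `|` W1 S) (tproj w).
Proof.
have core x : tdist x (tproj w) < delta S ->
    exists2 c, tproj c = x & enorm (w - c) < delta S.
  by rewrite tdistC => /tdist_lt[c cx wc]; exists c.
move=> zfar wz [|] /core[c cE wc].
- have := zfar c (or_introl cE); have := ler_enorm_distD w z c.
  by rewrite (enormBC z w); lra.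
- have := zfar c (or_intror cE); have := ler_enorm_distD w z c.
  by rewrite (enormBC z w); lra.
Qed.

(** A curve of length below [2 * delta] from a point at distance at least [3 * delta] from the lifts
    of [p] and [q] avoids [V1] and [W1], so its tangent vectors, which lie in [E], are contracted by
    [lam]. *)
Lemma lifted_disc_tlift z w l : far_from_pq (3 * delta S) z -> l <= 2 * delta S ->
  lifted_disc leaf z l w -> lifted_disc leaf (G z) (lam S * l) (G w).
Proof.
move=> zfar l2 [gam [gC g0 g1 gleaf gl]].
have [GgC GgE] := C1_curve_tlift g_diffeo gC.
exists (G \o gam); split.
- exact: GgC.
- by rewrite /= g0.
- by rewrite /= g1.
- by move=> t t01; rewrite -leaf_inv; exists (gam t) => //; exact: gleaf.
have lam0 := lam_gt0 HS.
apply: (@le_lt_trans _ _ (lam S * curve_length gam)); last by rewrite ltr_pM2l.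
apply: curve_length_le; [exact: GgC|exact: gC|] => t t01.
have -> := GgE t; set v := derive1 gam t.
have vE : (v <= E (tproj (gam t)))%MS.
  apply: (leaf_tangent HS leafC gleaf t01); apply: DeriveDef (gC.1 t) _.
  by rewrite /v derive1E.
have [->|v0] := eqVneq v 0; first by rewrite mul0mx enorm0 mulr0.
apply/ltW; have [lt _] := g_cs (E_cs vE) v0; apply: lt.
apply: far_notin_V1W1 zfar _; apply: lt_le_trans l2.
apply: le_lt_trans gl; rewrite -g0; apply: enorm_le_curve_length; first exact: gC.
by case/andP: t01 => t0 t1; rewrite !ltW.
Qed.

Lemma lifted_disc_enorm z w l : lifted_disc leaf z l w -> enorm (w - z) < l.
Proof.
move=> [gam [gC g0 g1 _ gl]]; apply: le_lt_trans gl; rewrite -g0 -g1.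
by apply: enorm_le_curve_length => //; rewrite ler01 lexx.
Qed.

Lemma lifted_disc_leaf z w l : lifted_disc leaf z l w -> leaf z w.
Proof. by move=> [gam [_ _ <- gleaf _]]; apply: gleaf; rewrite ler01 lexx. Qed.

Lemma lifted_disc_iter z w n :
  (forall i, (i < n)%N -> far_from_pq (3 * delta S) (iter i G z)) ->
  lifted_disc leaf z (2 * delta S) w ->
  lifted_disc leaf (iter n G z) (lam S ^+ n * (2 * delta S)) (iter n G w).
Proof.
elim: n => [|n IH] zfar zw; first by rewrite mul1r.
rewrite exprS -mulrA !iterS; apply: lifted_disc_tlift; first exact: zfar.
  have l0 := lam_gt0 HS; have l3 := lam3_lt1 HS; have d0 := delta_gt0 HS.
  rewrite ler_piMl ?mulr_ge0 ?(ltW d0)//; apply: exprn_ile1; lra.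
by apply: IH => // i iln; apply: zfar; exact: leqW.
Qed.

(** [leaf_disc] is defined at the lift [repr]; the invariance of the leaves under integer
    translations moves the disc to an arbitrary lift [z]. *)
Lemma leaf_disc_lift z rho y : leaf_disc leaf (tproj z) rho y ->
  exists2 w, lifted_disc leaf z rho w & tproj w = y.
Proof.
have [_ _ leafT _] := leafC.
set r := repr (tproj z); have rz : tproj r = tproj z by exact: tproj_repr.
move=> [_ [gam [gC g0 <- gleaf gl]] <-]; rewrite -/r in g0 gleaf.
have kZ : intvec (z - r) by apply/tprojP.
have kd t : is_derive t 1 (gam \+ cst (z - r)) (derive1 gam t).
  rewrite -[derive1 gam t]addr0; apply: is_deriveD.
  by apply: DeriveDef (gC.1 t) _; rewrite derive1E.
have kE : derive1 (gam \+ cst (z - r)) = derive1 gam.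
  by apply/funext => t; rewrite derive1E; exact: (@derive_val _ _ _ _ _ _ _ (kd t)).
exists (gam 1 + (z - r)); last by rewrite tprojD.
exists (gam \+ cst (z - r)); split.
- split; last by rewrite kE; exact: gC.2.
  by move=> t; exact: (@ex_derive _ _ _ _ _ _ _ (kd t)).
- rewrite /= g0; vec_ring.
- by [].
- by move=> t t01; rewrite (leafT _ _ rz); exists (gam t); [exact: gleaf|].
- by rewrite /curve_length kE; exact: gl.
Qed.

End DiscDynamics.

(** * Arcs avoiding the perturbed region in the past *)

Section ArcAvoidance.
Variable R : realType.

(** [c] is the infimum of the times at which [f] is at least [m]; continuity excludes [f c < m]. *)
Lemma first_hit (f : R -> R) (a b m : R) : a <= b -> continuous f ->
  f a <= m <= f b ->
  exists2 c, a <= c <= b & f c = m /\ forall t, a <= t <= c -> f t <= m.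
Proof.
move=> ab fc /andP[fa fb].
pose A := [set t | a <= t <= b /\ m <= f t].
have A0 : A !=set0 by exists b; rewrite /A/= lexx ab.
have Alb : has_lbound A by exists a => t [/andP[]].
pose c := inf A.
have cb : c <= b by apply: ge_inf => //; rewrite /A/= lexx ab.
have ac : a <= c by apply: lb_le_inf => // t [/andP[]].
have lt t : a <= t < c -> f t < m.
  move=> /andP[at_ tc]; rewrite ltNge; apply/negP => mf.
  have : c <= t by apply: ge_inf => //; split=> //; rewrite at_ (le_trans (ltW tc)).
  by rewrite leNgt tc.
have mfc : m <= f c.
  rewrite leNgt; apply/negP => fcm.
  have : \forall t \near c, f t < m by apply: (fc c [set x | x < m]); exact: lt_nbhsl.
  move=> /nbhs_ballP[e /= e0 ce].
  have [t [tab mt] tc] := inf_lt A0 (ltr_pwDr e0 (lexx c)).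
  have ct : c <= t by apply: ge_inf.
  suff : f t < m by rewrite ltNge mt.
  by apply: ce; rewrite /ball/= distrC ger0_norm ?subr_ge0// ltrBlDl.
have fcE : f c = m.
  have [|d] := @IVT _ f a c m ac (continuous_subspaceT fc).
    by rewrite ge_min le_max fa mfc orbT.
  rewrite in_itv/= => /andP[ad]; rewrite le_eqVlt => /predU1P[->//|dc] fd.
  by have := lt d; rewrite ad dc fd ltxx => /(_ isT).
exists c; first by rewrite ac cb.
split=> // t /andP[at_]; rewrite le_eqVlt => /predU1P[->|tc]; first by rewrite fcE.
by apply/ltW/lt; rewrite at_ tc.
Qed.

Lemma last_hit (f : R -> R) (a b m : R) : a <= b -> continuous f ->
  f a <= m <= f b ->
  exists2 c, a <= c <= b & f c = m /\ forall t, c <= t <= b -> m <= f t.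
Proof.
move=> ab fc /andP[fa fb].
have gc : continuous (fun t => - f (- t)).
  move=> t; apply: (@continuousN _ _ _ (fun t => f (- t))).
  apply: (@continuous_comp _ _ _ (fun t : R => - t) f); last exact: fc.
  exact: opp_continuous.
have [||c /andP[bc ca] [cE cP]] := @first_hit (fun t => - f (- t)) (- b) (- a) (- m) _ gc.
- by rewrite lerN2.
- by rewrite !opprK !lerN2 fb fa.
exists (- c); first by rewrite lerNr ca lerNl bc.
split; first by rewrite -[LHS]opprK cE opprK.
move=> t /andP[ct tb]; rewrite -lerN2 -[t]opprK; apply: cP.
by rewrite lerN2 tb lerNl.
Qed.

Variables (S : anosov_data R) (HS : anosov_setting S).
Variables (d : R) (Q : set 'rV[R]_3).
Hypothesis d0 : 0 < d.
Hypothesis Qfar : forall c c', Q c -> Q c' -> c <> c' -> 100 * d <= enorm (c - c').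

Local Notation Ps := (proj_s S).
Local Notation Pu := (proj_u S).
Local Notation iB := (map_mx intr (invmx (amat S)) : 'M[R]_3).

(* [14.85 = (40 - 0.1) / 2 - 5 - 0.1] exceeds [40 / 3], so the tripling of the
   stable part under backward iteration restores the size [40]. *)
Lemma subarc_avoiding (Y : R -> 'rV[R]_3) (a b : R) : a <= b -> continuous Y ->
  (forall s t, a <= s <= b -> a <= t <= b -> enorm ((Y s - Y t) *m Pu) <= d / 10) ->
  40 * d <= enorm ((Y b - Y a) *m Ps) ->
  exists a' b', [/\ a <= a', a' <= b', b' <= b,
    forall t c, a' <= t <= b' -> Q c -> 5 * d <= enorm (Y t - c) &
    40 * d <= 3 * enorm ((Y b' - Y a') *m Ps)].
Proof.
have d00 := d0; have Qf := Qfar.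
move=> ab Yc Yu Yab.
have nc (y : 'rV[R]_3) : continuous (fun t => enorm (Y t - y)).
  move=> t; apply: (@continuous_comp _ _ _ (fun t => Y t - y) (@enorm R)).
    by apply: continuousB; [exact: Yc|exact: cst_continuous].
  exact: enorm_continuous.
have sc : continuous (fun t => enorm ((Y t - Y a) *m Ps)).
  move=> t; apply: (@continuous_comp _ _ _ (fun t => (Y t - Y a) *m Ps) (@enorm R)).
    apply: (@continuous_comp _ _ _ (fun t => Y t - Y a) (fun v : 'rV[R]_3 => v *m Ps)).
      by apply: continuousB; [exact: Yc|exact: cst_continuous].
    exact: mulmxr_continuous.
  exact: enorm_continuous.
(* Cut the arc when its stable size first reaches [40 * d], so that all of it stays within
   [40.1 * d] of [Y a]. *)
have [|b1 /andP[ab1 b1b] [b1E b1P]] := first_hit (m := 40 * d) ab sc.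
  by rewrite subrr mul0mx enorm0 Yab andbT; lra.
have su s t : a <= s <= b -> a <= t <= b ->
    enorm (Y s - Y t) <= enorm ((Y s - Y t) *m Ps) + d / 10 /\
    enorm ((Y s - Y t) *m Ps) >= enorm (Y s - Y t) - d / 10.
  move=> sab tab; have := Yu s t sab tab.
  have := ler_enormD ((Y s - Y t) *m Ps) ((Y s - Y t) *m Pu).
  by rewrite (proj_su HS); lra.
have inb t : a <= t <= b1 -> a <= t <= b by move=> /andP[-> /le_trans->].
have aab : a <= a <= b by rewrite lexx.
have b1ab : a <= b1 <= b by rewrite ab1.
have close t : a <= t <= b1 -> enorm (Y t - Y a) <= 40 * d + d / 10.
  by move=> tab; have [h _] := su t a (inb t tab) aab; have := b1P t tab; lra.
have [avoid|] := pselect (forall t c, a <= t <= b1 -> Q c -> 5 * d <= enorm (Y t - c)).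
  by exists a, b1; split=> //; lra.
move=> /existsNP[t0 /existsNP[c /not_implyP[t0ab /not_implyP[Qc /negP]]]].
rewrite -ltNge => t0c.
(* Only one point of [Q] can be near the arc: each [Y t] is within [85.2 * d] of [c], and the other
   points of [Q] are at least [100 * d] from [c]. *)
have others t c' : a <= t <= b1 -> Q c' -> c' <> c -> 5 * d <= enorm (Y t - c').
  move=> tab Qc' c'c; have := Qf c' c Qc' Qc c'c.
  have := ler_enorm_distD (Y t) c' c; have := ler_enorm_distD (Y a) (Y t) c.
  have := ler_enorm_distD (Y t0) (Y a) c; have := close t tab; have := close t0 t0ab.
  rewrite (enormBC (Y a) (Y t0)) (enormBC c' (Y t)); lra.
have [at0 t0b1] := andP t0ab.
have bb : enorm (Y b1 - Y a) >= 40 * d - d / 10.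
  have := Yu b1 a b1ab aab; have := lerB_enorm (Y b1 - Y a) ((Y b1 - Y a) *m Pu).
  have := ler_enormB (Y b1 - Y a) ((Y b1 - Y a) *m Pu).
  have -> : Y b1 - Y a - (Y b1 - Y a) *m Pu = (Y b1 - Y a) *m Ps.
    by rewrite -{1}(proj_su HS (Y b1 - Y a)) addrK.
  by lra.
(* The endpoints are at least [39.9 * d] apart, so one of them is at least [19.95 * d] from [c]. The
   piece kept joins that endpoint to the nearest crossing of the sphere of radius [5 * d] around
   [c]. *)
have [rb|ra] : 19 * d + d * (95 / 100) <= enorm (Y b1 - c) \/
    19 * d + d * (95 / 100) <= enorm (Y a - c).
  have := ler_enorm_distD c (Y b1) (Y a); rewrite (enormBC c (Y a)).
  by case: (leP (19 * d + d * (95 / 100)) (enorm (Y b1 - c))) => h1 h2; [left|right]; lra.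
- have [|e /andP[t0e eb1] [eE eP]] := last_hit (m := 5 * d) t0b1 (nc c).
    by rewrite (ltW t0c); lra.
  have ae : a <= e by exact: le_trans t0e.
  exists e, b1; split=> //.
    move=> t c' /andP[et tb1] Qc'; have [->|/eqP c'c] := eqVneq c' c.
      by apply: eP; rewrite et.
    by apply: others => //; rewrite tb1 (le_trans ae).
  have eab : a <= e <= b by apply: inb; rewrite ae.
  have [_ h] := su b1 e b1ab eab.
  by have := ler_enorm_distD (Y e) (Y b1) c; lra.
- have Nc : continuous (fun t => - enorm (Y t - c)).
    by move=> t; apply: (@continuousN _ _ _ (fun t => enorm (Y t - c))); exact: nc.
  have [|e /andP[ae et0] [eE eP]] := first_hit (m := - (5 * d)) at0 Nc.
    by rewrite !lerN2 (ltW t0c) andbT; lra.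
  have eb1 : e <= b1 by exact: le_trans t0b1.
  exists a, e; split=> //; first exact: le_trans b1b.
    move=> t c' /andP[at_ te] Qc'; have [->|/eqP c'c] := eqVneq c' c.
      by rewrite -lerN2; apply: eP; rewrite at_.
    by apply: others => //; rewrite at_ (le_trans te).
  have eab : a <= e <= b by apply: inb; rewrite ae.
  have [_ h] := su e a eab aab.
  by have := ler_enorm_distD (Y e) (Y a) c; rewrite (enormBC (Y a) (Y e)); lra.
Qed.

Lemma nested_intervals (I : nat -> R * R) :
  (forall n, [/\ (I n).1 <= (I n.+1).1, (I n).1 <= (I n).2 & (I n.+1).2 <= (I n).2]) ->
  exists t, forall n, (I n).1 <= t <= (I n).2.
Proof.
move=> IP.
have a_mono n k : (I n).1 <= (I (n + k)%N).1.
  elim: k => [|k IH]; first by rewrite addn0.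
  by rewrite addnS (le_trans IH)//; have [] := IP (n + k)%N.
have b_mono n k : (I (n + k)%N).2 <= (I n).2.
  elim: k => [|k IH]; first by rewrite addn0.
  by rewrite addnS (le_trans _ IH)//; have [] := IP (n + k)%N.
have ab n m : (I n).1 <= (I m).2.
  apply: (le_trans (a_mono n m)); have [_ h _] := IP (n + m)%N.
  by apply: (le_trans h); rewrite addnC b_mono.
pose A := range (fun n => (I n).1).
exists (sup A) => n; apply/andP; split.
  by apply: ub_le_sup; [exists (I 0%N).2 => _ [m _ <-]|exists n].
by apply: ge_sup; [exists (I 0%N).1; exists 0%N|move=> _ [m _ <-]].
Qed.

(** [X n] is the [n]-th backward image of an arc. From time [n0] on, [subarc_avoiding] is applied
    repeatedly: each backward step restores the stable size [40 * d], and the nested parameter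
    intervals share a point [t]. *)
Lemma arc_avoiding (X : nat -> R -> 'rV[R]_3) :
  (forall n s t, X n s - X n t = (X 0%N s - X 0%N t) *m iB ^+ n) ->
  continuous (X 0%N) -> (X 0%N 1 - X 0%N 0) *m Ps != 0 ->
  exists t n0, 0 <= t <= 1 /\
    forall n c, (n0 <= n)%N -> Q c -> 5 * d <= enorm (X n t - c).
Proof.
move=> XE X0c X01.
have d00 := d0.
have XS n s t : X n.+1 s - X n.+1 t = (X n s - X n t) *m iB.
  by rewrite (XE n.+1) (XE n) mulmxXSr.
have Xc n : continuous (X n).
  rewrite (_ : X n = (fun=> X n 0) \+
      (fun t => (X 0%N t - X 0%N 0) *m iB ^+ n)); last first.
    by apply/funext => t /=; rewrite -XE; vec_ring.
  move=> t; apply: continuousD; first exact: cst_continuous.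
  apply: (@continuous_comp _ _ _ (fun t => X 0%N t - X 0%N 0)
    (fun v : 'rV[R]_3 => v *m iB ^+ n)).
    by apply: continuousB; [exact: X0c|exact: cst_continuous].
  exact: mulmxr_continuous.
have [M Mu] : exists M, forall s t, 0 <= s <= 1 -> 0 <= t <= 1 ->
    enorm ((X 0%N s - X 0%N t) *m Pu) <= M.
  pose f t := enorm ((X 0%N t - X 0%N 0) *m Pu).
  have fc : {within `[0, 1], continuous f}.
    apply: continuous_subspaceT => t.
    apply: (@continuous_comp _ _ _ (fun t => (X 0%N t - X 0%N 0) *m Pu) (@enorm R)).
      apply: (@continuous_comp _ _ _ (fun t => X 0%N t - X 0%N 0)
        (fun v : 'rV[R]_3 => v *m Pu)).
        by apply: continuousB; [exact: X0c|exact: cst_continuous].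
      exact: mulmxr_continuous.
    exact: enorm_continuous.
  have [c _ cP] := EVT_max ler01 fc.
  exists (2 * f c) => s t s01 t01.
  have fs : f s <= f c by apply: cP; rewrite in_itv.
  have ft : f t <= f c by apply: cP; rewrite in_itv.
  rewrite (_ : X 0%N s - X 0%N t = (X 0%N s - X 0%N 0) - (X 0%N t - X 0%N 0));
    last by vec_ring.
  rewrite mulmxBl.
  have := ler_enormB ((X 0%N s - X 0%N 0) *m Pu) ((X 0%N t - X 0%N 0) *m Pu).
  by rewrite -/(f s) -/(f t); lra.
(* [n1] steps bring the unstable spread below [d / 10], and [n2] steps bring the stable spread above
   [40 * d]. *)
have [n1 n1P] := exists_exp3_ge (M * 10 / d).
have s0 : 0 < enorm ((X 0%N 1 - X 0%N 0) *m Ps) by rewrite enorm_gt0.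
have [n2 n2P] := exists_exp3_ge (40 * d / enorm ((X 0%N 1 - X 0%N 0) *m Ps)).
pose n0 := (n1 + n2)%N.
have Xu n s t : (n0 <= n)%N -> 0 <= s <= 1 -> 0 <= t <= 1 ->
    enorm ((X n s - X n t) *m Pu) <= d / 10.
  move=> n0n s01 t01; rewrite XE.
  have e0 : 0 < 3 ^+ n :> R by exact: exprn_gt0.
  rewrite -(ler_pM2l e0) (le_trans (Eu_contractV_iter HS _ _))//.
  apply: (le_trans (Mu s t s01 t01)).
  rewrite ler_pdivrMr// in n1P.
  have le3 : 3 ^+ n1 <= 3 ^+ n :> R.
    by rewrite ler_eXn2l ?ltr1n// (leq_trans _ n0n)// leq_addr.
  have : 3 ^+ n1 * d <= 3 ^+ n * d by rewrite ler_pM2r.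
  by move: (3 ^+ n) (3 ^+ n1) n1P => x y; lra.
pose good n (I : R * R) := [/\ 0 <= I.1, I.1 <= I.2, I.2 <= 1 &
  40 * d <= enorm ((X (n0 + n)%N I.2 - X (n0 + n)%N I.1) *m Ps)].
(* The existential precedes the assumption [good n I] so that [choice] applies to all intervals; for
   a bad one, [I] itself is a dummy value. *)
have step n I : exists I', good n I -> [/\ good n.+1 I', I.1 <= I'.1, I'.2 <= I.2 &
   forall t c, I'.1 <= t <= I'.2 -> Q c -> 5 * d <= enorm (X (n0 + n)%N t - c)].
  have [gI|] := pselect (good n I); last by exists I.
  case: I gI => a b [/= a0 ab b1 gab].
  have in01 t : a <= t <= b -> 0 <= t <= 1.
    by move=> /andP[at_ tb]; rewrite (le_trans a0)//= (le_trans tb).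
  have [|a' [b' [aa' a'b' b'b avoid big]]] := subarc_avoiding ab (Xc (n0 + n)%N) _ gab.
    by move=> s t /in01 s01 /in01 t01; apply: Xu => //; exact: leq_addr.
  exists (a', b') => _; split=> //.
  split=> /=; [exact: le_trans aa'|exact: a'b'|exact: le_trans b1|].
  apply: (le_trans big); rewrite addnS XS.
  exact: Es_expandV.
have [f fP] := choice (fun nI : nat * (R * R) => step nI.1 nI.2).
pose I := fix I n := if n is m.+1 then f (m, I m) else (0, 1) : R * R.
have Ig n : good n (I n).
  elim: n => [|n IH]; last by have [] := fP (n, I n) IH.
  split; rewrite /= ?ler01 ?lexx//.
  rewrite addn0 XE; apply: le_trans (Es_expandV_iter HS _ _).
  rewrite ler_pdivrMr// in n2P; apply: (le_trans n2P); rewrite ler_pM2r//.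
  by rewrite ler_eXn2l ?ltr1n// leq_addl.
have [|t tP] := @nested_intervals I.
  by move=> n; have [_ ? ? _] := fP (n, I n) (Ig n); have [_ ? _ _] := Ig n; split.
exists t, n0; split; first exact: tP 0%N.
move=> n c n0n Qc; have [_ _ _ avoid] := fP ((n - n0)%N, I (n - n0)%N) (Ig (n - n0)%N).
rewrite /= subnKC// in avoid; apply: avoid Qc.
(* The arc [X n] avoids [Q] on the interval produced by step [n - n0], whose index is one higher. *)
exact: tP (n - n0).+1.
Qed.

End ArcAvoidance.

(** * Local constancy of the stable component *)

Lemma exp3_bounded_eq0 (R : realType) (x M : R) :
  0 <= x -> (forall n, 3 ^+ n * x <= M) -> x = 0.
Proof.
move=> x0 xM; apply/eqP; rewrite eq_le x0 andbT leNgt; apply/negP => xgt0.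
have [n nP] := exists_exp3_ge ((M + 1) / x).
by have := xM n; rewrite ler_pdivrMr// in nP; move: (_ * x) nP => y; lra.
Qed.

(** Lifts of distinct points are separated by [balls_far]. Lifts of the same point differ by a
    lattice vector of norm at least 1, and [100 * delta <= 1] because distances on the torus are at
    most 3/2. *)
Lemma fixed_points_far (R : realType) (S : anosov_data R) (HS : anosov_setting S) :
  forall c c', tproj c = fix_p S \/ tproj c = fix_q S ->
    tproj c' = fix_p S \/ tproj c' = fix_q S -> c <> c' ->
    100 * delta S <= enorm (c - c').
Proof.
have d0 := delta_gt0 HS.
have pq : 200 * delta S < tdist (fix_p S) (fix_q S).
  have [[_ pq] _ _] := balls_far HS; apply: lt_le_trans pq _.
  have self x : tball x (6 * delta S) x.
    by rewrite /tball/= (le_lt_trans (tdistxx x))//; lra.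
  apply: ge_inf.
    exists 0 => _ [x _ [y _ <-]]; rewrite -(tproj_repr x) -(tproj_repr y).
    apply: lb_le_inf => [|_ [a _ [b _ <-]]]; last exact: enorm_ge0.
    by exists (eucl_dist (repr x) (repr y)), (repr x) => //; exists (repr y).
  by exists (fix_p S); [exact: self|exists (fix_q S); [exact: self|]].
have d1 : 100 * delta S <= 1 by have := tdist_le_lift (fix_p S) (fix_q S); lra.
have same (c c' : 'rV[R]_3) : tproj c = tproj c' -> c <> c' ->
    100 * delta S <= enorm (c - c').
  move=> /tprojP cc' ne; apply: le_trans d1 _; apply: intvec_ge1 => //.
  by rewrite subr_eq0; exact/eqP.
have diff (c c' : 'rV[R]_3) : tproj c = fix_p S -> tproj c' = fix_q S ->
    100 * delta S <= enorm (c - c').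
  by move=> cp cq; have := tdist_le c c'; rewrite cp cq; lra.
move=> c c' [cp|cq] [cp'|cq'] ne.
- by apply: same => //; rewrite cp cp'.
- exact: diff.
- by rewrite enormBC; exact: diff.
- by apply: same => //; rewrite cq cq'.
Qed.

Section LocalProduct.
Variables (R : realType) (S : anosov_data R) (HS : anosov_setting S).
Variables (eps kappa beta : R) (g h : torus R -> torus R).
Variables (Gi H : 'rV[R]_3 -> 'rV[R]_3).
Variables (leaf : 'rV[R]_3 -> set 'rV[R]_3) (E : torus R -> 'M[R]_3).
Hypotheses (g_diffeo : C1_diffeo g) (eps_lt : eps < delta S).
Local Notation G := (tlift g).
Hypothesis gh : semiconj_lift S eps g h G Gi H.
Hypothesis leafC : C1_close_foliation (Es S) (Eu S) kappa leaf E.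
Hypothesis leaf_inv : preserves_foliation g leaf.
Hypothesis E_cs : forall x (v : 'rV[R]_3), (v <= E x)%MS -> Ccs S x v.
Hypothesis g_cs : cs_contraction S beta g.
Hypotheses (g_inv : cone_invariance S g) (g_exp : cone_expansion S g).
Hypothesis g_meets : forall gam, tangent_curve (Cu S) gam ->
  curve_length gam = Lu S ->
  forall x, hits_disc gam (leaf_disc leaf x (2 * delta S)).
Implicit Types (a b u v w z : 'rV[R]_3) (x y : torus R).

(** An unstable component would grow like [3 ^+ n] under iteration, but it stays bounded: leaves are
    graphs of height below [kappa] and [H] is within [eps] of the identity. *)
Lemma H_leaf z w : leaf z w -> (H w - H z) *m proj_u S = 0.
Proof.
move=> zw; apply/eqP; rewrite -enorm_eq0; apply/eqP.
have [K K0 KP] := enorm_mulmx_le (proj_u S).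
apply: (@exp3_bounded_eq0 _ _ (kappa + K * (2 * eps))); first exact: enorm_ge0.
move=> n; apply: (le_trans (Eu_expand_iter HS _ n)).
rewrite -(H_iterG gh); set w' := iter n G w; set z' := iter n G z.
have leaf' : leaf z' w'.
  rewrite /w' /z'; elim: n {w' z'} => //= n IH.
  by rewrite -leaf_inv; exists (iter n G w).
have le1 := leaf_proj_u HS leafC leaf'.
rewrite (_ : H w' - H z' = (w' - z') + ((H w' - w') - (H z' - z'))); last by vec_ring.
rewrite mulmxDl; apply: (le_trans (ler_enormD _ _)); apply: lerD; first exact: ltW.
apply: (le_trans (KP _)); rewrite ler_pM2l//.
have := ler_enormB (H w' - w') (H z' - z').
by have := sl_H_close gh w'; have := sl_H_close gh z'; lra.
Qed.

Variables (U : set (torus R)) (rho : R).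
Hypotheses (U_trap : trapping g U) (U_ne : U !=set0) (U_margin : trapping_margin g U rho).

Lemma trapped_iter x n : U x -> U (iter n g x).
Proof.
move=> Ux; elim: n => //= n IH; apply: U_trap.2; exists (iter n g x) => //.
exact: subset_closure.
Qed.

(** By contradiction: if the stable component varied between [a] and [b], some point of [U] would
    have its image within [rho] of [tproj a], and the margin would force [tproj a] into [U]. *)
Lemma H_locally_unstable a b : ~ U (tproj a) -> enorm (b - a) < rho ->
  (H b - H a) *m proj_s S = 0.
Proof.
move=> aU ab; apply/eqP/negPn/negP => Hab.
have d0 := delta_gt0 HS; have epsl := eps_lt.
pose gam t := a + t *: (b - a).
have gc : continuous gam.
  have [[gd _] _] := segment_C1 a (b - a).
  by move=> t; apply: differentiable_continuous; apply/derivable1_diffP; exact: gd.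
pose X n t := H (iter n Gi (gam t)).
have XE n s t : X n s - X n t =
    (X 0%N s - X 0%N t) *m (map_mx intr (invmx (amat S)) : 'M[R]_3) ^+ n.
  exact: (H_iterGi HS gh).
have X0c : continuous (X 0%N).
  by move=> t; apply: (@continuous_comp _ _ _ gam H); [exact: gc|exact: sl_H_cont gh _].
have X01 : (X 0%N 1 - X 0%N 0) *m proj_s S != 0.
  rewrite /X /= (_ : gam 1 = b); last by rewrite /gam; vec_ring.
  by rewrite (_ : gam 0 = a); last by rewrite /gam; vec_ring.
have [t [n0 [/andP[t0 t1] avoid]]] := arc_avoiding HS d0 (fixed_points_far HS) XE X0c X01.
pose z n := iter n Gi (gam t).
(* [H] moves points by less than [eps < delta], so [5 * delta] for [H (z n)] leaves more than
   [3 * delta] for [z n]. *)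
have zfar n : (n0 <= n)%N -> far_from_pq S (3 * delta S) (z n).
  move=> n0n c cQ; have := avoid n c n0n cQ; rewrite /X -/(z n).
  by have := ler_enorm_distD (z n) (H (z n)) c; have := sl_H_close gh (z n); lra.
have za : enorm (gam t - a) < rho.
  rewrite (_ : gam t - a = t *: (b - a)); last by rewrite /gam; vec_ring.
  rewrite enormZ ger0_norm//; apply: le_lt_trans ab.
  by rewrite -[leRHS]mul1r ler_wpM2r ?enorm_ge0.
have [e e0 eV] : exists2 e, 0 < e &
    forall w, enorm (w - z n0) < e -> enorm (iter n0 G w - a) < rho.
  have r0 : 0 < rho - enorm (gam t - a) by rewrite subr_gt0.
  have ic : {for z n0, continuous (iter n0 G)} by exact: (iterG_cont gh).
  have := (continuous_enormP _ _).1 ic _ r0.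
  move=> /nbhs_enormP[e e0 eP]; exists e => // w /eP.
  rewrite (iterGiK gh); have := ler_enorm_distD (gam t) (iter n0 G w) a; lra.
(* From [4 * delta <= 3 ^+ m * e] and [3 * lam < 1], the disc of radius [2 * delta] contracted [m]
   times fits in the ball of radius [e]. *)
have [m mP] := exists_exp3_ge (4 * delta S / e).
rewrite ler_pdivrMr// in mP.
have small : lam S ^+ m * (2 * delta S) < e.
  have l0 := lam_gt0 HS; have l3 := lam3_lt1 HS.
  have : (3 * lam S) ^+ m <= 1 by apply: exprn_ile1; lra.
  rewrite exprMn; have : 0 < 3 ^+ m :> R by exact: exprn_gt0.
  have : 0 < lam S ^+ m by exact: exprn_gt0.
  by move: (3 ^+ m) (lam S ^+ m) mP => p q; nra.
have [|x Ux] := trapping_hits_discs HS g_diffeo g_inv g_exp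
    (D := leaf_disc leaf (tproj (z (n0 + m)%N)) (2 * delta S)) U_trap U_ne.
  by move=> gam' gT gL; exact: g_meets.
move=> /(leaf_disc_lift leafC)[w zw wx].
have zE i : (i <= m)%N -> iter i G (z (n0 + m)%N) = z (n0 + (m - i))%N.
  move=> im; rewrite /z -[in LHS](subnKC im) addnCA iterD.
  exact: (iterGiK gh).
have zw' : lifted_disc leaf (z n0) (lam S ^+ m * (2 * delta S)) (iter m G w).
  have := @lifted_disc_iter _ _ HS _ g_diffeo _ _ _ _ leafC leaf_inv E_cs g_cs _ _ m _ zw.
  rewrite zE// subnn addn0; apply=> i im; rewrite zE; last exact: ltnW.
  by apply: zfar; exact: leq_addr.
(* The point [iter (n0 + m) G w] lies over [iter (n0 + m).+1 g x], the image of a point of [U], and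
   is within [rho] of [a]. *)
have wV := eV _ (lt_trans (lifted_disc_enorm zw') small).
apply: aU; apply: (U_margin.2 (iter (n0 + m)%N g x)); first exact: trapped_iter.
apply: le_lt_trans wV; apply: le_trans (tdist_le _ _).
by rewrite !(tproj_iterG gh) wx -iterD -iterSr.
Qed.

Lemma leaf_disc_sub_fiber x : ~ U x -> leaf_disc leaf x rho `<=` h @^-1` [set h x].
Proof.
move=> xU _ [w zw <-] /=.
have HE : H w = H (repr x).
  apply: subr0_eq; rewrite -(proj_su HS (H w - H (repr x))).
  rewrite (H_leaf (lifted_disc_leaf zw)) H_locally_unstable ?addr0//.
    by rewrite tproj_repr.
  exact: lifted_disc_enorm zw.
by rewrite -(sl_H_lift gh) HE (sl_H_lift gh) tproj_repr.
Qed.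

End LocalProduct.

(** * Periodicity *)

(** The unit cube is cut into cells of side [1 / N]; as [N > 3 / rho], two points of one cell are
    closer than [rho]. *)
Lemma exists_small_boxes (R : realType) (rho : R) : 0 < rho ->
  exists (T : finType) (box : 'rV[R]_3 -> T), forall u v, box u = box v ->
    exists2 k, intvec k & enorm (u - v - k) < rho.
Proof.
move=> rho0; pose N := Num.bound (3 / rho).
have NP : 3 / rho < N%:R by apply: archi_boundP; rewrite divr_ge0// ltW.
have N0 : 0 < N%:R :> R by apply: le_lt_trans NP; rewrite divr_ge0// ltW.
have unit_cube (v : 'rV[R]_3) : exists r : 'rV[R]_3,
    intvec (v - r) /\ forall i, 0 <= r 0 i < 1.
  have [k kZ vk] := exists_unit_cube v; exists (v - k); split=> //.
  by rewrite subKr.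
have [r rP] := choice unit_cube.
pose digit v i := Num.truncn (N%:R * r v 0 i).
have digitP v i : (digit v i)%:R <= N%:R * r v 0 i < (digit v i).+1%:R.
  by apply: truncn_itv; rewrite mulr_ge0 ?(ltW N0)//; have [_ /(_ i)/andP[]] := rP v.
exists {ffun 'I_3 -> 'I_N.+1}, (fun v => [ffun i => inord (digit v i)]) => u v uv.
have dE i : digit u i = digit v i.
  have dN w : (digit w i < N.+1)%N.
    rewrite -(ltr_nat R); have /andP[le _] := digitP w i; apply: le_lt_trans le _.
    have [_ /(_ i)/andP[_ lt]] := rP w.
    by apply: (@lt_trans _ _ N%:R); rewrite ?ltr_nat// -[ltRHS]mulr1 ltr_pM2l.
  move/ffunP/(_ i)/(congr1 val): uv; rewrite !ffunE /= !inordK//; exact: dN.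
exists ((u - r u) - (v - r v)).
  by apply: intvecB; [exact: (rP u).1|exact: (rP v).1].
have -> : u - v - (u - r u - (v - r v)) = r u - r v by vec_ring.
apply: (@le_lt_trans _ _ (3 * N%:R^-1)).
  apply: enorm_le_coord => i; rewrite -(ler_pM2l N0) mulfV ?gt_eqF//.
  rewrite -{1}(gtr0_norm N0) -normrM !mxE mulrBr.
  have := digitP u i; have := digitP v i; rewrite dE -natr1 ler_norml.
  by move=> /andP[? ?] /andP[? ?]; apply/andP; split; lra.
by rewrite ltr_pdivrMr// mulrC -ltr_pdivrMr.
Qed.

Section Periodicity.
Variables (R : realType) (S : anosov_data R) (HS : anosov_setting S).
Implicit Types (u v w e k : 'rV[R]_3) (x y : torus R).

Local Notation A := (Amap S).
Local Notation B := (rmat S).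
Local Notation iB := (map_mx intr (invmx (amat S)) : 'M[R]_3).
Local Notation Ps := (proj_s S).
Local Notation Pu := (proj_u S).

Lemma iter_Amap_tproj v n : iter n A (tproj v) = tproj (v *m B ^+ n).
Proof.
by elim: n => [|n IH]; [rewrite mulmx1|rewrite iterS IH Amap_tproj mulmxXSr].
Qed.

Lemma intvecMX k (M : 'M[int]_3) n :
  intvec k -> intvec (k *m (map_mx intr M : 'M[R]_3) ^+ n).
Proof.
move=> kZ; elim: n => [|n IH]; first by rewrite mulmx1.
by rewrite mulmxXSr; exact: intvecM.
Qed.

Lemma Amap_inj : injective A.
Proof.
move=> x y; rewrite -(tproj_repr x) -(tproj_repr y) !Amap_tproj => /tprojP.
rewrite -mulmxBl => /(@intvecM R _ (invmx (amat S))).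
by rewrite -mulmxA rmatK// mulmx1 => /tprojP.
Qed.

Lemma iter_Amap_inj n : injective (iter n A).
Proof. by elim: n => [//|n IH] x y; rewrite !iterS => /Amap_inj/IH. Qed.

Lemma iter_period y l n : iter l A y = y -> iter (n * l) A y = y.
Proof. by move=> yl; elim: n => [//|n IH]; rewrite mulSn iterD IH. Qed.

Lemma proj_s0_iterV e n : e *m Ps = 0 -> e *m iB ^+ n *m Ps = 0.
Proof.
move=> es; elim: n => [|n IH]; first by rewrite mulmx1.
by rewrite mulmxXSr proj_s_commV// IH mul0mx.
Qed.

Lemma Eu_back_to0 e r : e *m Ps = 0 -> 0 < r ->
  exists n0, forall n, (n0 <= n)%N -> enorm (e *m iB ^+ n) < r.
Proof.
move=> eu r0.
have [n0 nP] := exists_exp3_ge ((enorm (e *m Pu) + 1) / r); exists n0 => n n0n.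
rewrite -(proj_su HS (e *m iB ^+ n)) proj_s0_iterV// add0r.
have e0 : 0 < 3 ^+ n :> R by exact: exprn_gt0.
rewrite -(ltr_pM2l e0); apply: (le_lt_trans (Eu_contractV_iter HS _ _)).
rewrite ler_pdivrMr// in nP.
have le3 : 3 ^+ n0 * r <= 3 ^+ n * r by rewrite ler_pM2r// ler_eXn2l ?ltr1n.
by move: (3 ^+ n * r) (3 ^+ n0 * r) nP le3 => p q; lra.
Qed.

(* The difference of the lifts is [e A^-n] modulo the lattice for infinitely
   many [n], hence a limit of lattice points. *)
Lemma intvec_of_recurrent u v r :
  (forall n0, exists n k e, [/\ (n0 <= n)%N, intvec k, e *m Ps = 0, enorm e < r &
     (u - v) *m B ^+ n = k + e]) ->
  intvec (u - v).
Proof.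
move=> rec; apply: intvec_closed => d d0.
have [K K0 KP] := enorm_mulmx_le Pu.
have [n0 nP] := exists_exp3_ge (K * r / d).
have [n [k [e [n0n kZ es er E]]]] := rec n0.
exists (k *m iB ^+ n); first exact: intvecMX.
have -> : u - v - k *m iB ^+ n = e *m iB ^+ n.
  by rewrite -(mulmxXK (u - v) n (rmatK HS)) E mulmxDl addrC addKr.
rewrite -(proj_su HS (e *m iB ^+ n)) proj_s0_iterV// add0r.
have e0 : 0 < 3 ^+ n :> R by exact: exprn_gt0.
rewrite -(ltr_pM2l e0); apply: (le_lt_trans (Eu_contractV_iter HS _ _)).
apply: (le_lt_trans (KP _)); rewrite ler_pdivrMr// in nP.
apply: (@lt_le_trans _ _ (K * r)); first by rewrite ltr_pM2l.
by apply: (le_trans nP); rewrite ler_pM2r// ler_eXn2l ?ltr1n.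
Qed.

(** Backward iteration over a common multiple of the periods fixes both points and makes [e]
    arbitrarily short modulo the lattice, so [e] is a limit of lattice vectors and hence one
    itself. *)
Lemma periodic_unstable_eq v e l l' : (0 < l)%N -> (0 < l')%N -> e *m Ps = 0 ->
  iter l A (tproj v) = tproj v -> iter l' A (tproj (v + e)) = tproj (v + e) ->
  tproj (v + e) = tproj v.
Proof.
move=> l0 l'0 es vl vel; apply/tprojP; rewrite addrC addKr.
apply: intvec_closed => r r0; have [n0 nP] := Eu_back_to0 es r0.
pose q := (n0 * (l * l'))%N.
have n0q : (n0 <= q)%N by rewrite /q leq_pmulr// muln_gt0 l0.
have back w m : iter m A (tproj w) = tproj w -> tproj (w *m iB ^+ m) = tproj w.
  move=> wm; apply: (@iter_Amap_inj m); rewrite wm iter_Amap_tproj.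
  by rewrite mulmxXK// rmatVK.
have vq : tproj (v *m iB ^+ q) = tproj v.
  by apply: back; rewrite /q (mulnC l) mulnA; exact: iter_period.
have veq : tproj ((v + e) *m iB ^+ q) = tproj (v + e).
  by apply: back; rewrite /q mulnA; exact: iter_period.
exists (e - e *m iB ^+ q); last by rewrite subKr; exact: nP.
move/tprojP: vq => vq; move/tprojP: veq => veq.
have -> : e - e *m iB ^+ q = (v *m iB ^+ q - v) - ((v + e) *m iB ^+ q - (v + e)).
  by rewrite mulmxDl; vec_ring.
exact: intvecB.
Qed.

Variables (eps : R) (g h : torus R -> torus R) (G Gi H : 'rV[R]_3 -> 'rV[R]_3).
Hypothesis gh : semiconj_lift S eps g h G Gi H.
Hypothesis hg : forall x, h (g x) = A (h x).
Variables (U : set (torus R)) (rho : R).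
Hypothesis rho0 : 0 < rho.
Hypothesis H_loc : forall a b, ~ U (tproj a) -> enorm (b - a) < rho ->
  (H b - H a) *m Ps = 0.

Lemma semiconj_iter x n : h (iter n g x) = iter n A (h x).
Proof. by elim: n => //= n <-; exact: hg. Qed.

Lemma untrapped_periodic x : (forall n, ~ U (iter n g x)) ->
  exists2 l, (0 < l)%N & iter l A (h x) = h x.
Proof.
move=> xU; pose u n := iter n G (repr x).
have uE n : tproj (u n) = iter n g x by rewrite /u (tproj_iterG gh) tproj_repr.
have [T [box boxP]] := exists_small_boxes rho0.
pose N := #|T|.
have pigeon n : exists i j : 'I_N.+1, (i < j)%N /\ box (u (n + i)%N) = box (u (n + j)%N).
  have /injectivePn[i [j ij E]] : ~~ injectiveb (fun i : 'I_N.+1 => box (u (n + i)%N)).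
    by apply/injectiveP => /leq_card; rewrite card_ord ltnn.
  have [lt|gt|/val_inj eq] := ltngtP i j; last by rewrite eq eqxx in ij.
    by exists i, j.
  by exists j, i; rewrite E.
(* Some pair of offsets recurs for arbitrarily large [n]: otherwise each pair would stop recurring
   after some bound, and the maximum of these bounds would contradict [pigeon]. *)
have [i [j [ij rec]]] : exists i j : 'I_N.+1, (i < j)%N /\
    forall n0, exists2 n, (n0 <= n)%N & box (u (n + i)%N) = box (u (n + j)%N).
  apply: contrapT => no.
  have bound (ij : 'I_N.+1 * 'I_N.+1) : exists n0, (ij.1 < ij.2)%N ->
      forall n, (n0 <= n)%N -> box (u (n + ij.1)%N) <> box (u (n + ij.2)%N).
    have [lt|ge] := boolP (ij.1 < ij.2)%N; last by exists 0%N.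
    apply: contrapT => nb; apply: no; exists ij.1, ij.2; split=> // n0.
    apply: contrapT => nn; apply: nb; exists n0 => _ n n0n E; apply: nn.
    by exists n.
  have [n0 n0P] := choice bound.
  have [i [j [lt E]]] := pigeon (\max_ij n0 ij).
  exact: (n0P (i, j) lt _ (leq_bigmax (i, j)) E).
exists (j - i)%N; first by rewrite subn_gt0.
(* By injectivity of [A] it suffices that the [i]-th and [j]-th images of [h x] coincide. *)
apply: (@iter_Amap_inj i); rewrite -iterD subnKC ?(ltnW ij)//.
rewrite -!semiconj_iter -!uE -!(sl_H_lift gh); apply/tprojP.
apply: (@intvec_of_recurrent _ _ (rho + 2 * eps)) => n0.
have [n n0n E] := rec n0; have [k kZ uk] := boxP _ _ E.
(* [b] is the integer translate of [u (n + j)] that lies near [a], so [H b - H a] is purely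
   unstable. *)
pose b := u (n + j)%N + k; pose a := u (n + i)%N.
have ab : enorm (b - a) < rho.
  rewrite enormBC (_ : a - b = u (n + i)%N - u (n + j)%N - k)//.
  by rewrite /a /b; vec_ring.
have es : (H b - H a) *m Ps = 0 by apply: H_loc ab; rewrite uE; exact: xU.
have k'Z : intvec (H b - H (u (n + j)%N)).
  by apply/tprojP; rewrite !(sl_H_lift gh) tprojD.
exists n, (- (H b - H (u (n + j)%N))), (H b - H a); split=> //.
- exact: intvecN.
- rewrite (_ : H b - H a = (b - a) + ((H b - b) - (H a - a))); last by vec_ring.
  have := ler_enormD (b - a) ((H b - b) - (H a - a)).
  have := ler_enormB (H b - b) (H a - a).
  by have := sl_H_close gh a; have := sl_H_close gh b; lra.
- rewrite -(H_iterG gh) /u -!iterD -/(u _) -/(u _) -/a; vec_ring.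
Qed.

(** Each jump alters [H] only along [Eu]. Pulled back to time 0 the jumps add up to a vector [e], so
    the pseudo-orbit is followed by a true orbit of [A] on the unstable leaf of [h x]. *)
Lemma untrapped_pseudo_orbit (x : torus R) (f : nat -> torus R) (k : nat) :
  f 0%N = x -> (forall i, (i <= k)%N -> ~ U (f i)) ->
  (forall i, (i < k)%N -> tdist (g (f i)) (f i.+1) < rho) ->
  exists2 e, e *m Ps = 0 & iter k A (tproj (H (repr x) + e)) = h (f k).
Proof.
move=> f0 fU fg; elim: k fU fg => [|k IH] fU fg.
  by exists 0; [rewrite mul0mx|rewrite addr0 (sl_H_lift gh) tproj_repr f0].
have [i ik|i ik|e es eE] := IH; [exact/fU/leqW|exact/fg/leqW|].
have := fg k (ltnSn k); rewrite -(tproj_repr (g (f k))) => /tdist_lt[b bE ab].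
set a := repr (g (f k)) in ab.
have ds : (H a - H b) *m Ps = 0 by apply: H_loc ab; rewrite bE; exact: fU.
set d := H a - H b in ds.
exists (e - d *m iB ^+ k.+1); first by rewrite mulmxBl es proj_s0_iterV// subr0.
have aE : tproj (H a) = tproj ((H (repr x) + e) *m B ^+ k.+1).
  by rewrite (sl_H_lift gh) /a tproj_repr hg -eE -iterS iter_Amap_tproj.
rewrite iter_Amap_tproj addrA mulmxBl mulmxXK ?rmatVK// -bE -(sl_H_lift gh).
apply/tprojP; move/esym/tprojP: aE.
rewrite (_ : _ - H a = (H (repr x) + e) *m B ^+ k.+1 - d - H b)//.
by rewrite /d; vec_ring.
Qed.

End Periodicity.

(** * Periodic images of a whole class lie on one orbit of [A] *)

Theorem theorem3 (R : realType) (S : anosov_data R) (HS : anosov_setting S) :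
  exists2 c : R, 0 < c &
  forall eps nu beta kappa : R,
    0 < eps < c -> 0 < nu < c -> 0 < beta < c -> 0 < kappa < c ->
    semiconjugacy_constant S eps nu ->
  forall f : torus R -> torus R, modified_diffeo S nu beta f ->
  forall (U : set (torus R -> torus R))
    (pc qc rc : (torus R -> torus R) -> torus R)
    (Fcs : (torus R -> torus R) -> 'rV[R]_3 -> set 'rV[R]_3)
    (Ecs : (torus R -> torus R) -> torus R -> 'M[R]_3),
    good_neighborhood S nu beta kappa f U pc qc rc Fcs Ecs ->
  forall g h : torus R -> torus R, U g -> semiconjugacy S eps g h ->
  forall Lam : set (torus R), quasi_attractor g Lam ->
  forall C : set (torus R), chain_class g C -> C <> Lam ->
    exists2 O : set (torus R), periodic_orbit (Amap S) O &
      C `<=` relative_interior (Fcs g) h O.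
Proof.
have d0 := delta_gt0 HS.
(* The bound [delta] serves the distance estimates to the lifts of [p] and [q]; the bound 1/4 makes
   the lift of [h] unique. *)
exists (Num.min (delta S) 4^-1); first by rewrite lt_min d0; lra.
move=> eps nu beta kappa /andP[eps0]; rewrite lt_min => /andP[epsd eps4] _ _ _ _.
move=> f _ U pc qc rc Fcs Ecs nb g h Ug gh Lam [LamC [V [Vo _ VE gV]]] C CC CneLam.
have g_diffeo : C1_diffeo g := (nb_open nb).1 _ Ug.
have g_cont : continuous g := lifts_continuous (tlift_lifts g_diffeo).
have [Gi [H lift]] := exists_semiconj_lift HS g_diffeo gh eps4.
have hg : forall x, h (g x) = Amap S (h x) by case: gh.
(* Classes are equivalence classes, so [C] contained in [Lam] would force equality. *)
have [x0 Cx0 x0Lam] : exists2 x, C x & ~ Lam x.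
  apply: contrapT => no; apply: CneLam; apply: chain_class_subset_eq CC LamC _ => x Cx.
  by apply: contrapT => xL; apply: no; exists x.
have [n x0V] : exists n, ~ V n x0.
  apply: contrapT => no; apply: x0Lam; rewrite VE => n _.
  by apply: contrapT => xV; apply: no; exists n.
have trap : trapping g (V n) by split; [exact: (Vo n).1|exact: gV].
have [rho margin] := exists_trapping_margin g_cont trap.
have V_ne : V n !=set0.
  have [y yr LamE] := LamC; exists y; apply: (Vo n).2; rewrite LamE.
  by split=> // e e0; split; exact: yr.
have CV x : C x -> ~ V n x.
  move=> Cx Vx; apply: x0V.
  exact: chain_class_trapped g_cont _ _ _ _ CC trap Cx Cx0 Vx.
have [_ _ E_cs] := nb_bundle nb Ug.
have leafC := nb_foliation nb Ug; have leaf_inv := nb_preserved nb Ug.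
have H_loc := H_locally_unstable HS g_diffeo epsd lift leafC leaf_inv E_cs
  (nb_cs nb Ug) (nb_cone_inv nb Ug) (nb_cone_exp nb Ug) (nb_meets nb Ug)
  trap V_ne margin.
have periodic x : C x -> exists2 l, (0 < l)%N & iter l (Amap S) (h x) = h x.
  move=> Cx; apply: (untrapped_periodic HS lift hg margin.1 H_loc) => m Vm.
  apply: (CV x Cx); apply: chain_recurrent_iter_trapped trap Vm => //.
  exact: chain_class_recurrent CC Cx.
have [l l0 hl] := periodic x0 Cx0.
exists (range (fun k => iter k (Amap S) (h x0))); first by exists (h x0), l.
move=> x Cx; exists (h x); last first.
  split=> //; exists rho; first exact: margin.1.
  apply: (leaf_disc_sub_fiber HS g_diffeo epsd lift leafC leaf_inv E_cs
    (nb_cs nb Ug) (nb_cone_inv nb Ug) (nb_cone_exp nb Ug) (nb_meets nb Ug)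
    trap V_ne margin); exact: CV.
have [] := chain_class_equiv CC Cx0 Cx margin.1.
move=> [k [u [k1 u0 uk ug]]] _.
have uV i : (i <= k)%N -> ~ V n (u i).
  move=> ik Vi; apply: (CV x Cx); rewrite -uk.
  by apply: trapped_tail margin ug Vi _; rewrite ik leqnn.
have [e es eE] := untrapped_pseudo_orbit HS lift hg H_loc u0 uV ug.
have Y0 : tproj (H (repr x0)) = h x0 by rewrite (sl_H_lift lift) tproj_repr.
have [l' l'0 hl'] := periodic x Cx.
(* The point [tproj (H (repr x0) + e)] has [k]-th image [h x], hence is itself periodic by
   injectivity; being on the unstable leaf of the periodic point [h x0], it equals [h x0]. *)
have eq0 : tproj (H (repr x0) + e) = tproj (H (repr x0)).
  apply: (periodic_unstable_eq HS l0 l'0 es); first by rewrite Y0.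
  by apply: (@iter_Amap_inj _ _ HS k); rewrite -iterD addnC iterD eE uk hl'.
by exists k => //; rewrite -Y0 -eq0 eE uk.
Qed.
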